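(* Let $N\ge1$, $1\le p<\infty$, and let $a_j>0$, $b_j>0$ for $j=1,\dots,N$. Assume that $X$ has the $p$-Generalized Dirichlet distribution with parameter $(\mathbf a,\mathbf b)=(a_1,\dots,a_N,b_1,\dots,b_N)$ on $\mathbb{B}_{N,p}$, and let $C=(C_1,\dots,C_N)=\mathcal{C}_N(X)$ be the vector of canonical coordinates of $X$. Then: (i) the random variables $C_1,\dots,C_N$ are independent; (ii) for $j=1,\dots,N$, $C_j\stackrel{d}{=}\varepsilon_jZ_j^{1/p}$, where $\varepsilon_j$ and $Z_j$ are independent, $\varepsilon_j$ is Rademacher distributed, and $Z_j\stackrel{d}{=}\mathrm{Beta}(a_j,b_j)$. In other words, the law of $C_j$ has density $$x\mapsto\frac{p\,\Gamma(a_j+b_j)}{2\,\Gamma(a_j)\Gamma(b_j)}\,|x|^{pa_j-1}(1-|x|^p)^{b_j-1}\mathbf 1_{(-1,1)}(x).$$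
   Context: $\mathbb{B}_{N,p}=\{x\in\mathbb{R}^N:\|x\|_p=(\sum_{i=1}^N|x_i|^p)^{1/p}<1\}$. For $x\in\mathbb{R}^N$, $x^{(k)}=(x_1,\dots,x_k)$ and $\|x^{(0)}\|_p=0$. Canonical coordinates: $\mathcal{C}_N:\mathbb{B}_{N,p}\to(-1,1)^N$, $\mathcal{C}_N(x)=(c_1,\dots,c_N)$ with $c_k=x_k/(1-\|x^{(k-1)}\|_p^p)^{1/p}$, $k=1,\dots,N$ (so $c_1=x_1$). Generalized Dirichlet distribution: $\mathcal{S}_N^<=\{(x_1,\dots,x_N):x_i>0\ \forall i,\ \sum_i x_i<1\}$, and $\mathcal{GD}_{\mathbf a,\mathbf b}$ is the probability distribution on $\mathcal{S}_N^<$ with Lebesgue density $$\frac1{\mathcal{Z}(\mathbf a,\mathbf b)}\,p_{N+1}^{b_N-1}\prod_{j=1}^N\Big[p_j^{a_j-1}(1-p_1-\dots-p_{j-1})^{b_{j-1}-(a_j+b_j)}\Big],\qquad p_{N+1}=1-p_1-\dots-p_N,$$ with $\mathcal{Z}(\mathbf a,\mathbf b)=\prod_{j=1}^N\Gamma(a_j)\Gamma(b_j)/\Gamma(a_j+b_j)$ (for $j=1$ the base of the last power is $1$, so $b_0$ plays no role). $p$-Generalized Dirichlet distribution on $\mathbb{B}_{N,p}$ with parameter $(\mathbf a,\mathbf b)$: the law of $(\varepsilon_1\rho_1^{1/p},\dots,\varepsilon_N\rho_N^{1/p})$, where $(\rho_1,\dots,\rho_N)$ has distribution $\mathcal{GD}_{\mathbf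 a,\mathbf b}$ and the $\varepsilon_i$ are independent Rademacher variables ($\pm1$ with probability $1/2$), independent of $(\rho_1,\dots,\rho_N)$. $\mathrm{Beta}(a,b)$ has density proportional to $x^{a-1}(1-x)^{b-1}$ on $(0,1)$. *)

(* Defs.v *)
From HB Require Import structures.
From mathcomp Require Import all_boot all_order all_algebra.
From mathcomp Require Import all_classical all_reals all_analysis.
From mathcomp Require Import measurable_realfun.

Set Implicit Arguments.
Unset Strict Implicit.
Unset Printing Implicit Defensive.

Import Order.TTheory GRing.Theory Num.Theory.
Import numFieldNormedType.Exports.

Local Open Scope classical_set_scope.
Local Open Scope ring_scope.

(* R^n is represented by n.-tuple R with its product sigma-algebra; its
   Lebesgue measure is built by iterated products, transported along
   (x, (x_1, ..., x_n)) |-> (x, x_1, ..., x_n). The type measurableTypeR R is R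
   with the copy of its Borel sigma-algebra on which the library defines
   lebesgue_measure. *)
Section tuple_lebesgue.
Context {R : realType}.

Definition cons_pair n (x : measurableTypeR R * n.-tuple R) : n.+1.-tuple R :=
  [tuple of (x.1 : R) :: x.2].

Lemma measurable_cons_pair n : measurable_fun setT (@cons_pair n).
Proof. exact: measurable_cons. Qed.

Let uncons n (t : n.+1.-tuple R) : measurableTypeR R * n.-tuple R :=
  (thead t, [tuple of behead t]).

Let measurable_uncons n : measurable_fun setT (@uncons n).
Proof.
by apply/measurable_fun_pair; [exact: measurable_tnth|exact: measurable_behead].
Qed.

Section cons_lebesgue.
Context n (mu : {sigma_finite_measure set (n.-tuple R) -> \bar R}).

Definition cons_lebesgue : set (n.+1.-tuple R) -> \bar R :=
  pushforward (@lebesgue_measure R \x mu)%E (@cons_pair n).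

Let nu : {measure set (n.+1.-tuple R) -> \bar R} :=
  measure_function_pushforward__canonical__measure_function_Measure
    (@lebesgue_measure R \x mu)%E (@measurable_cons_pair n).

HB.instance Definition _ := isMeasure.Build _ _ _ cons_lebesgue
  (measure0 nu) (measure_ge0 nu) (@measure_semi_sigma_additive _ _ _ nu).

Let prod_sigma_finite : sigma_finite setT (@lebesgue_measure R \x mu)%E.
Proof.
have /sigma_finiteP[F [TF ndF Foo]] := sigma_finiteT (@lebesgue_measure R).
have /sigma_finiteP[G [TG ndG Goo]] := sigma_finiteT mu.
exists (fun n => F n `*` G n).
  rewrite -setXTT TF TG predeqE => -[x y]; split.
    move=> [/= [i _ Fix] [k _ Gky]]; exists (maxn i k) => //; split.
    - by move: x Fix; exact/subsetPset/ndF/leq_maxl.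
    - by move: y Gky; exact/subsetPset/ndG/leq_maxr.
  by move=> [i _ []/= ? ?]; split; exists i.
move=> k; have [? ?] := Foo k; have [? ?] := Goo k.
split; first exact: measurableX.
by rewrite product_measure1E// lte_mul_pinfty// ge0_fin_numE.
Qed.

Let cons_lebesgue_sigma_finite : sigma_finite setT cons_lebesgue.
Proof.
have [F FT mF] := prod_sigma_finite.
exists (fun k => @uncons n @^-1` F k).
  by rewrite -preimage_bigcup -FT preimage_setT.
move=> k; have [mFk Fk] := mF k; split.
  by rewrite -[X in measurable X]setTI; exact: measurable_uncons.
rewrite /cons_lebesgue /pushforward -comp_preimage (_ : @uncons n \o _ = id)//.
apply/funext => -[x t] /=; rewrite /uncons /cons_pair/=; congr pair.
exact/val_inj.
Qed.

HB.instance Definition _ := Measure_isSigmaFinite.Build _ _ _ cons_lebesgue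
  cons_lebesgue_sigma_finite.

End cons_lebesgue.

Fixpoint tuple_lebesgue n : {sigma_finite_measure set (n.-tuple R) -> \bar R} :=
  match n with
  | 0 => \d_[tuple]
  | m.+1 => cons_lebesgue (tuple_lebesgue m)
  end.

Lemma tuple_lebesgue_box n (A : 'I_n -> set R) :
  (forall i, measurable (A i)) ->
  tuple_lebesgue n [set x | forall i, A i (tnth x i)] =
    (\prod_(i < n) lebesgue_measure (A i))%E.
Proof.
elim: n A => [|n IH] A mA.
  rewrite big_ord0 /= diracE (_ : [set _ | _] = setT) ?in_setT//.
  by apply/seteqP; split => // x _ [].
rewrite big_ord_recl -IH => [|i]; last exact: mA.
rewrite /= /cons_lebesgue /pushforward -product_measure1E//; last first.
  rewrite (_ : mkset _ = \bigcap_(i in [set: 'I_n])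
      (fun x : n.-tuple R => tnth x i) @^-1` A (lift ord0 i)).
    apply: fin_bigcap_measurable => // i _.
    by rewrite -[X in measurable X]setTI; exact: measurable_tnth.
  by apply/seteqP; split=> x /= H i; [move=> _; exact: H|exact: (H i Logic.I)].
  exact: (mA ord0).
congr (_ _); apply/seteqP; split => -[x t] /=; rewrite /cons_pair/=.
  move=> H; split; first by have := H ord0.
  by move=> i; have := H (lift ord0 i); rewrite tnthS.
move=> [Ax H] i; have [->//|i0] := eqVneq i ord0.
by case: (unliftP ord0 i) i0 => [j ->|->]; rewrite ?eqxx// tnthS.
Qed.

End tuple_lebesgue.

Section probability.
Context {R : realType}.

Definition eq_law d1 d2 d (T1 : measurableType d1) (T2 : measurableType d2)
    (U : measurableType d) (P : probability T1 R) (Q : probability T2 R)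
    (X : {RV P >-> U}) (Y : {RV Q >-> U}) :=
  forall A, measurable A -> distribution P X A = distribution Q Y A.

Definition has_density d (T : measurableType d) (P : probability T R)
    (X : {RV P >-> R}) (f : R -> R) :=
  forall A, measurable A ->
    distribution P X A = (\int[lebesgue_measure]_(x in A) (f x)%:E)%E.

Definition has_tuple_density d (T : measurableType d) (P : probability T R) N
    (X : {RV P >-> N.-tuple R}) (f : N.-tuple R -> R) :=
  forall A, measurable A ->
    distribution P X A = (\int[tuple_lebesgue N]_(x in A) (f x)%:E)%E.

Definition independent_pair d d1 d2 (T : measurableType d)
    (U1 : measurableType d1) (U2 : measurableType d2) (P : probability T R)
    (X : {RV P >-> U1}) (Y : {RV P >-> U2}) :=
  forall A B, measurable A -> measurable B ->
    P (X @^-1` A `&` Y @^-1` B) = (P (X @^-1` A) * P (Y @^-1` B))%E.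

Definition mutual_independent d d' (T : measurableType d)
    (U : measurableType d') (I : finType) (P : probability T R)
    (X : I -> {RV P >-> U}) :=
  forall (J : {set I}) (A : I -> set U), (forall i, measurable (A i)) ->
    P (\bigcap_(i in [set` J]) X i @^-1` A i) =
    (\prod_(i in J) P (X i @^-1` A i))%E.

Definition rv_coord d (T : measurableType d) N (X : T -> N.-tuple R)
    (i : 'I_N) : T -> R := fun t => tnth (X t) i.

HB.instance Definition _ d (T : measurableType d) N
    (X : {mfun T >-> N.-tuple R}) i :=
  isMeasurableFun.Build _ _ _ _ (rv_coord X i)
    (measurableT_comp (measurable_tnth i) (@measurable_funPT _ _ _ _ X)).

Definition rademacher d (T : measurableType d) (P : probability T R)
    (eps : {RV P >-> R}) :=
  P (eps @^-1` [set 1]) = (2^-1)%:E /\ P (eps @^-1` [set -1]) = (2^-1)%:E.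

Definition Gamma (x : R) : R :=
  (\int[lebesgue_measure]_(t in `]0, +oo[) (t `^ (x - 1) * expR (- t)))%R.

Definition beta_distributed d (T : measurableType d) (P : probability T R)
    (Z : {RV P >-> R}) (a b : R) :=
  exists c : R, has_density Z
    (fun x => c * (x `^ (a - 1) * (1 - x) `^ (b - 1)) * \1_`]0, 1[ x).

(* eps Z^{1/p} *)
Definition signed_root d (T : measurableType d) (p : R) (eps Z : T -> R) :
    T -> R :=
  fun t => eps t * Z t `^ p^-1.

Lemma measurable_signed_root d (T : measurableType d) p (eps Z : T -> R) :
  measurable_fun setT eps -> measurable_fun setT Z ->
  measurable_fun setT (signed_root p eps Z).
Proof.
move=> meps mZ; apply: measurable_funM => //.
exact: (measurableT_comp (measurable_powR _)).
Qed.

HB.instance Definition _ d (T : measurableType d) p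
    (eps Z : {mfun T >-> R}) :=
  isMeasurableFun.Build _ _ _ _ (signed_root p eps Z)
    (measurable_signed_root p (@measurable_funPT _ _ _ _ eps)
      (@measurable_funPT _ _ _ _ Z)).

Definition signed_roots d (T : measurableType d) N (p : R)
    (eps rho : T -> N.-tuple R) : T -> N.-tuple R :=
  fun t => [tuple signed_root p (rv_coord eps i) (rv_coord rho i) t | i < N].

Lemma measurable_signed_roots d (T : measurableType d) N p
    (eps rho : {mfun T >-> N.-tuple R}) :
  measurable_fun setT (signed_roots p eps rho).
Proof.
apply/measurable_fun_tnthP => i.
rewrite (_ : _ \o _ = signed_root p (rv_coord eps i) (rv_coord rho i))//.
by apply/funext => t /=; rewrite tnth_mktuple.
Qed.

HB.instance Definition _ d (T : measurableType d) N p
    (eps rho : {mfun T >-> N.-tuple R}) :=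
  isMeasurableFun.Build _ _ _ _ (signed_roots p eps rho)
    (measurable_signed_roots p eps rho).

End probability.
Arguments eq_law {R d1 d2 d T1 T2 U} P Q X Y.
Arguments has_density {R d T} P X f.
Arguments has_tuple_density {R d T} P {N} X f.
Arguments independent_pair {R d d1 d2 T U1 U2} P X Y.
Arguments mutual_independent {R d d' T U I} P X.
Arguments rademacher {R d T} P eps.
Arguments beta_distributed {R d T} P Z a b.

Section generalized_dirichlet.
Context {R : realType} {N : nat}.
Implicit Types (a b : N.-tuple R) (x : N.-tuple R).

Definition simplex : set (N.-tuple R) :=
  [set x | (forall i, 0 < tnth x i) /\ \sum_(i < N) tnth x i < 1].

Definition gd_norm a b : R :=
  \prod_(j < N)
    (Gamma (tnth a j) * Gamma (tnth b j) / Gamma (tnth a j + tnth b j)).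

(* Indices are shifted by one: b`_N.-1 is the last entry b_N, and for j > 0 the
   entry preceding tnth b j is b`_j.-1. For j = 0 the power has base 1, so
   that the value b`_0.-1 = b`_0 is irrelevant. *)
Definition gd_density a b x : R :=
  (gd_norm a b)^-1
  * (1 - \sum_(i < N) tnth x i) `^ (b`_N.-1 - 1)
  * \prod_(j < N)
      (tnth x j `^ (tnth a j - 1)
       * (1 - \sum_(i < N | (i < j)%N) tnth x i)
           `^ (b`_j.-1 - (tnth a j + tnth b j)))
  * \1_simplex x.

Definition gd_distributed d (T : measurableType d) (P : probability T R)
    (rho : {RV P >-> N.-tuple R}) a b :=
  has_tuple_density P rho (gd_density a b).

Definition p_gd_distributed d (T : measurableType d) (P : probability T R)
    (X : {RV P >-> N.-tuple R}) (p : R) a b :=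
  exists (d' : measure_display) (T' : measurableType d')
    (Q : probability T' R) (eps rho : {RV Q >-> N.-tuple R}),
    [/\ gd_distributed rho a b,
        forall i, rademacher Q (rv_coord eps i),
        mutual_independent Q (fun i => rv_coord eps i),
        independent_pair Q eps rho &
        eq_law P Q X (signed_roots p eps rho)].

End generalized_dirichlet.
Arguments gd_distributed {R N d T} P rho a b.
Arguments p_gd_distributed {R N d T} P X p a b.

Section canonical_coordinates.
Context {R : realType}.

Definition pnorm (p : R) (s : seq R) : R :=
  (\sum_(x <- s) `|x| `^ p) `^ p^-1.

(* The vector of canonical coordinates is only meaningful on the open unit ball
   for pnorm, which carries all the mass of the p-generalized Dirichlet
   distribution. *)
Definition canonical_coords N (p : R) (x : N.-tuple R) : N.-tuple R :=
  [tuple tnth x k / (1 - pnorm p (take k x) `^ p) `^ p^-1 | k < N].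

Let measurable_pnorm_take N p k :
  measurable_fun setT (fun x : N.-tuple R => pnorm p (take k x)).
Proof.
apply: (measurableT_comp (measurable_powR _)).
rewrite (_ : (fun _ => _) = fun x : N.-tuple R =>
    \sum_(i <- index_enum 'I_N) (i < k)%:R * `|tnth x i| `^ p).
  apply: measurable_sum => i; apply: measurable_funM => //.
  apply: (measurableT_comp (measurable_powR _)).
  by apply: measurableT_comp => //; exact: measurable_tnth.
apply/funext => x.
rewrite (big_nth 0) size_take size_tuple big_mkord -/(minn k N).
under [RHS]eq_bigr do rewrite mulr_natl mulrb.
rewrite -big_mkcond/=.
rewrite (big_ord_widen_cond N xpredT (fun i => `|nth 0 (take k x) i| `^ p)).
  apply: eq_big => [i|i]; first by rewrite leq_min ltn_ord andbT.
  move=> /andP[_]; rewrite leq_min => /andP[ik _].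
  by rewrite nth_take// (tnth_nth 0).
exact: geq_minr.
Qed.

Lemma measurable_canonical_coords N p :
  measurable_fun setT (@canonical_coords N p).
Proof.
apply/measurable_fun_tnthP => k.
rewrite (_ : _ \o _ = fun x : N.-tuple R =>
    tnth x k * (1 - pnorm p (take k x) `^ p) `^ (- p^-1)); last first.
  by apply/funext => x /=; rewrite tnth_mktuple powRN.
apply: measurable_funM; first exact: measurable_tnth.
apply: (measurableT_comp (measurable_powR _)).
apply: measurable_funB => //.
by apply: (measurableT_comp (measurable_powR _)); exact: measurable_pnorm_take.
Qed.

HB.instance Definition _ N p := isMeasurableFun.Build _ _ _ _
  (@canonical_coords N p) (@measurable_canonical_coords N p).

End canonical_coordinates.

(* Main.v *)
From HB Require Import structures.
Require Import Defs.
From mathcomp Require Import all_boot all_order all_algebra.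
From mathcomp Require Import all_classical all_reals all_analysis.
From mathcomp Require Import measurable_realfun ring lra.
Import Order.TTheory GRing.Theory Num.Theory.
Import numFieldNormedType.Exports.
Import HBNNSimple.
Local Open Scope classical_set_scope.
Local Open Scope ring_scope.

Set Implicit Arguments.
Unset Strict Implicit.
Unset Printing Implicit Defensive.

(* Write [r_j = 1 - x_1 - ... - x_j]. The generalized Dirichlet density is, up
   to its constant, the product over [j] of
   [r_(j-1)^-1 * beta_(a_j, b_j) (x_j / r_(j-1))], a stick-breaking form: by
   Tonelli and the scaling of Lebesgue measure, integrating the last variables
   out first, the ratios [Z_j = rho_j / (1 - rho_1 - ... - rho_(j-1))] are
   independent with Beta laws. The canonical coordinates of [X] are
   [eps_j * Z_j^(1/p)]; summing over the sign patterns of [eps] gives their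
   joint law as a product, and the substitution [z = x^p] gives the density.
   The constants come from [Gamma a * Gamma b = Gamma (a + b) * B(a, b)]
   (Tonelli again). The convergence of the Gamma integrals need not be proved:
   the Dirichlet density has total mass 1, so its constant is nonzero. *)

(** * Changes of variables for nonnegative integrals on the real line *)

Section change_of_variables.
Local Open Scope ereal_scope.

(** Here [nu] is the image under [phi] of the measure with density [g] with respect to [mu]. For
    indicators the formula is the hypothesis on [nu]; linearity extends it to simple functions, and
    monotone convergence to [f]. *)
Lemma ge0_integral_weighted_pushforward d1 d2 (X : measurableType d1)
    (Y : measurableType d2) (R : realType) (mu : {measure set X -> \bar R})
    (nu : {measure set Y -> \bar R}) (phi : X -> Y) (g : X -> R)
    (f : Y -> \bar R) :
  measurable_fun setT phi -> measurable_fun setT g -> (forall x, 0 <= g x)%R ->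
  (forall A, measurable A -> nu A = \int[mu]_(x in phi @^-1` A) (g x)%:E) ->
  measurable_fun setT f -> (forall y, 0 <= f y) ->
  \int[nu]_y f y = \int[mu]_x (f (phi x) * (g x)%:E).
Proof.
move=> mphi mg g0 nuE mf f0; have mgE : measurable_fun setT (EFin \o g).
  exact/measurable_EFinP.
pose h := nnsfun_approx measurableT mf.
have hf y : (h n y)%:E @[n --> \oo] --> f y.
  by apply: cvg_nnsfun_approx => // *; exact: f0.
have mhphi n : measurable_fun setT (h n \o phi) by exact: measurableT_comp.
have -> : \int[nu]_y f y = limn (fun n => \int[nu]_y (h n y)%:E).
  rewrite -monotone_convergence//.
  - by apply: eq_integral => y _; apply/esym/cvg_lim => //; exact: hf.
  - by move=> n; exact/measurable_EFinP.
  - by move=> n y _; rewrite lee_fin.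
  - by move=> y _ m n mn; rewrite lee_fin; exact/lefP/nd_nnsfun_approx.
have -> : \int[mu]_x (f (phi x) * (g x)%:E) =
    limn (fun n => \int[mu]_x ((h n (phi x))%:E * (g x)%:E)).
  rewrite -monotone_convergence//.
  - apply: eq_integral => x _; apply/esym/cvg_lim => //.
    by apply: cvgeZr => //; exact: hf.
  - by move=> n; apply: emeasurable_funM => //; exact/measurable_EFinP/mhphi.
  - by move=> n y _; rewrite mule_ge0 ?lee_fin.
  - move=> y _ m n mn; rewrite lee_wpmul2r ?lee_fin//.
    exact/lefP/nd_nnsfun_approx.
congr (limn _); apply/funext => n.
have mpre r : measurable (phi @^-1` (h n @^-1` [set r])).
  by rewrite -[X in measurable X]setTI; exact: mphi.
transitivity (\sum_(r \in range (h n))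
    \int[nu]_y (r * \1_(h n @^-1` [set r]) y)%:E).
  under eq_integral do rewrite fimfunE -fsumEFin//.
  rewrite ge0_integral_fsum//.
  - by move=> r; exact/measurable_EFinP/measurable_funM.
  - by move=> r y _; rewrite nnfun_muleindic_ge0.
transitivity (\sum_(r \in range (h n)) \int[mu]_x
    ((r * \1_(h n @^-1` [set r]) (phi x))%:E * (g x)%:E)); last first.
  rewrite -ge0_integral_fsum//.
  - apply: eq_integral => x _; rewrite fimfunE -fsumEFin//.
    by rewrite ge0_mule_fsuml// => r; exact: nnfun_muleindic_ge0.
  - move=> r; apply: emeasurable_funM => //; apply/measurable_EFinP.
    by apply: measurable_funM => //; exact: measurableT_comp.
  - by move=> r x _; rewrite mule_ge0 ?lee_fin// -lee_fin nnfun_muleindic_ge0.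
apply: eq_fsbigr => r; rewrite inE => -[y _ hnr].
have r0 : (0 <= r)%R by rewrite -hnr.
under eq_integral do rewrite EFinM.
rewrite ge0_integralZl//; last exact/measurable_EFinP.
under [RHS]eq_integral do rewrite EFinM -muleA.
rewrite ge0_integralZl//; last 2 first.
  apply: emeasurable_funM => //; apply/measurable_EFinP.
  by apply: measurableT_comp.
  by move=> x _; rewrite mule_ge0 ?lee_fin.
rewrite integral_indic// setIT nuE//; congr (_ * _).
rewrite integral_mkcond; apply: eq_integral => x _.
by rewrite epatch_indic muleC.
Qed.

Context {R : realType}.
Implicit Types (f : R -> \bar R) (phi g : R -> R).

(** A test on half-open intervals is enough: they determine Lebesgue measure, so the image under
    [phi] of the measure with density [g] must be Lebesgue measure itself. *)
Lemma lebesgue_change_of_variables phi g f :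
  measurable_fun setT phi -> measurable_fun setT g -> (forall x, 0 <= g x)%R ->
  (forall u v : R, (u < v)%R ->
    \int[lebesgue_measure]_(x in phi @^-1` `]u, v]) (g x)%:E = (v - u)%:E) ->
  measurable_fun setT f -> (forall y, 0 <= f y) ->
  \int[lebesgue_measure]_y f y =
  \int[lebesgue_measure]_x (f (phi x) * (g x)%:E).
Proof.
move=> mphi mg g0 guv mf f0.
have mpre A : measurable A -> measurable (phi @^-1` A).
  by move=> mA; rewrite -[X in measurable X]setTI; exact: mphi.
apply: (ge0_integral_weighted_pushforward (X := measurableTypeR R)
  (Y := measurableTypeR R)) => //.
pose nu0 (A : set (measurableTypeR R)) :=
  \int[lebesgue_measure]_(x in phi @^-1` A) (g x)%:E.
have nu00 : nu0 set0 = 0 by rewrite /nu0 preimage_set0 integral_set0.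
have nu0_ge0 A : 0 <= nu0 A by apply: integral_ge0 => x _; rewrite lee_fin.
have nu0_add : semi_sigma_additive nu0.
  move=> F mF tF mUF; rewrite /nu0 preimage_bigcup ge0_integral_bigcup//.
  - by apply: is_cvg_ereal_nneg_natsum_cond => n _ _; exact: nu0_ge0.
  - by move=> k; apply: mpre; exact: mF.
  - exact/measurable_EFinP/measurable_funTS.
  - by move=> x _; rewrite lee_fin.
  - by move=> i j _ _ [x [Fix Fjx]]; apply: tF => //; exists (phi x).
pose nu : {measure set (measurableTypeR R) -> \bar R} :=
  HB.pack nu0 (isMeasure.Build _ _ _ nu0 nu00 nu0_ge0 nu0_add).
apply: (lebesgue_measure_unique (mu := nu)) => _ [[u v] _ <-]/=.
rewrite /nu0; have [uv|vu] := ltP u v.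
  by rewrite guv// lebesgue_measure_itv/= lte_fin uv EFinB.
by rewrite set_itv_ge ?bnd_simp -?leNgt// preimage_set0 integral_set0 measure0.
Qed.

Lemma integral_affine (c e : R) f : (0 < c)%R ->
  measurable_fun setT f -> (forall y, 0 <= f y) ->
  \int[lebesgue_measure]_y f y =
  \int[lebesgue_measure]_x (f (c * x + e)%R * c%:E).
Proof.
move=> c0 mf f0.
apply: (@lebesgue_change_of_variables (fun x => c * x + e)%R (fun=> c)) => //.
- by apply: measurable_funD => //; exact: measurable_funM.
- by move=> x; exact: ltW.
move=> u v uv; rewrite (_ : _ @^-1` _ = `](u - e) / c, (v - e) / c]%classic)%R.
  rewrite integral_cst//= lebesgue_measure_itv/= lte_fin.
  rewrite ltr_pM2r ?invr_gt0// ltrD2r uv -EFinB -EFinM -mulrBl mulrC.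
  by rewrite divfK ?gt_eqF// opprB addrA subrK.
apply/seteqP; split => x /=; rewrite !in_itv/=;
  by rewrite ltr_pdivrMr// ler_pdivlMr// ltrBlDr lerBrDr mulrC.
Qed.

Lemma integral_oppr f : measurable_fun setT f -> (forall y, 0 <= f y) ->
  \int[lebesgue_measure]_y f y = \int[lebesgue_measure]_x f (- x)%R.
Proof.
move=> mf f0; rewrite (@lebesgue_change_of_variables -%R (fun=> 1%R))//.
- by apply: eq_integral => x _; rewrite mule1.
- move=> u v uv.
  rewrite integral_cst//; last by rewrite opp_preimage_itvbndbnd.
  rewrite mul1e opp_preimage_itvbndbnd/= lebesgue_measure_itv/= lte_fin ltrN2 uv.
  by rewrite -EFinB opprK addrC.
Qed.

Lemma powR_derivable_oo_LRcontinuous (q u v : R) : (0 < q)%R -> (0 <= u)%R ->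
  (u < v)%R -> derivable_oo_LRcontinuous (fun x : R => x `^ q)%R u v.
Proof.
move=> q0 u0 uv.
have cont (x : R) : (0 < x)%R -> {for x, continuous (fun x : R => x `^ q)%R}.
  move=> x0; apply/differentiable_continuous/derivable1_diffP.
  by apply: derivable_powR; rewrite in_itv/= x0.
split.
- move=> x; rewrite in_itv/= => /andP[ux _]; apply: derivable_powR.
  by rewrite in_itv/= (le_lt_trans u0).
- move: u0; rewrite le_eqVlt => /predU1P[<-|u0].
    by rewrite powR0 ?gt_eqF//; exact: powR_cvg0.
  by apply: cvg_at_right_filter; exact: cont.
- by apply: cvg_at_left_filter; apply: cont; exact: le_lt_trans uv.
Qed.

Lemma integral_powR_subr1 (p u v : R) : (1 <= p)%R -> (0 <= u)%R ->
  (u <= v)%R ->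
  \int[lebesgue_measure]_(x in `]u, v]) (p * x `^ (p - 1))%:E =
  (v `^ p - u `^ p)%:E.
Proof.
move=> p1 u0; rewrite le_eqVlt => /predU1P[->|uv].
  by rewrite set_itvoc0 integral_set0 subrr.
have p0 : (0 < p)%R by exact: lt_le_trans p1.
rewrite integral_itv_obnd_cbnd; last first.
  apply/measurable_EFinP/measurable_funTS; exact: measurable_funM.
rewrite (@continuous_FTC2 _ _ (fun x => x `^ p)%R) ?EFinB//.
(* For [p = 1] the integrand is the constant 1, even at 0, since [0 ^ 0 = 1]. For [p > 1] the
   exponent [p - 1] is positive, so the integrand is continuous up to a left endpoint 0. *)
- move: p1; rewrite le_eqVlt => /predU1P[<-|p1].
    rewrite (_ : (fun x => _) = fun=> 1%R).
      by apply: continuous_subspaceT => x; exact: cvg_cst.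
    by apply/funext => x; rewrite subrr powRr0 mulr1.
  have pN1 : (0 < p - 1)%R by rewrite subr_gt0.
  have /derivable_oo_LRcontinuous_within cw :=
    powR_derivable_oo_LRcontinuous pN1 u0 uv.
  move=> x; apply: cvgM; [exact: cvg_cst|exact: cw].
- exact: powR_derivable_oo_LRcontinuous.
- move=> x; rewrite in_itv/= => /andP[ux _]; apply: powR_derive1.
  by rewrite in_itv/= (le_lt_trans u0).
Qed.

Lemma integral_powR (p : R) f : (1 <= p)%R ->
  measurable_fun setT f -> (forall y, 0 <= f y) ->
  (forall y, (y <= 0)%R -> f y = 0) ->
  \int[lebesgue_measure]_y f y =
  \int[lebesgue_measure]_(x in `]0%R, +oo[)
    (f (x `^ p)%R * (p * x `^ (p - 1))%:E).
Proof.
move=> p1 mf f0 fN0; have p0 : (0 < p)%R by exact: lt_le_trans p1.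
(* The power is continued by the identity, with weight 1, to an increasing bijection of the whole
   line, so that preimages of intervals are intervals. The added part contributes nothing because
   [f] vanishes there. *)
pose phi (x : R) := (if 0 < x then x `^ p else x)%R.
pose g (x : R) := (if 0 < x then p * x `^ (p - 1) else 1)%R.
have mlt : measurable_fun setT (fun x : R => 0 < x)%R.
  exact: measurable_fun_ltr.
rewrite (@lebesgue_change_of_variables phi g)//.
- rewrite [RHS]integral_mkcond; apply: eq_integral => x _.
  rewrite patchE mem_setE in_itv/= andbT /phi /g; case: ltP => // x0.
  by rewrite fN0// mul0e.
- exact: measurable_fun_ifT.
- apply: measurable_fun_ifT => //; exact: measurable_funM.
- by move=> x; rewrite /g; case: ifP => // _; rewrite mulr_ge0 ?powR_ge0// ltW.
move=> u v uv.
(* [psi] is the inverse of [phi]; it gives the endpoints of the preimages. *)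
pose psi (y : R) := (if 0 < y then y `^ p^-1 else y)%R.
have psiK (y : R) : (0 <= y -> psi y `^ p = y)%R.
  rewrite /psi; case: ltgtP => // [y0 _|<- _].
    by rewrite -powRrM mulVf ?gt_eqF// powRr1// ltW.
  by rewrite powR0 ?gt_eqF.
have psi0 (y : R) : (0 <= y)%R -> (0 <= psi y)%R.
  by rewrite /psi; case: ifP => // *; exact: powR_ge0.
have psi_gt0 (y : R) : (0 < psi y)%R = (0 < y)%R.
  by rewrite /psi; case: (ltP 0%R y) => y0; [exact: powR_gt0|rewrite ltNge y0].
have psiN (y : R) : (y <= 0)%R -> psi y = y by rewrite /psi ltNge => ->.
have phi_gt (y x : R) : (y < phi x)%R = (psi y < x)%R.
  rewrite /phi; case: (ltP 0%R x) => x0.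
    case: (leP 0%R y) => y0.
      rewrite -[in LHS](psiK y)//.
      apply/idP/idP; last first.
        by apply: gt0_ltr_powR => //; rewrite nnegrE ?psi0// ltW.
      apply: contraTT; rewrite -!leNgt.
      by apply: ge0_ler_powR; rewrite ?nnegrE ?psi0// ltW.
    rewrite psiN ?(ltW y0)// (lt_trans y0 x0).
    by rewrite (lt_le_trans y0)// powR_ge0.
  case: (leP y 0%R) => y0; first by rewrite psiN.
  have px0 : (0 < psi y)%R by rewrite psi_gt0.
  by rewrite !ltNge (le_trans x0 (ltW y0)) (le_trans x0 (ltW px0)).
have phi_in x : (phi x \in `]u, v])%R = (x \in `]psi u, psi v])%R.
  by rewrite !in_itv/= phi_gt [(phi x <= v)%R]leNgt phi_gt -leNgt.
rewrite (_ : phi @^-1` _ = `]psi u, psi v]%classic); last first.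
  by apply/funext => x; rewrite /preimage /mkset phi_in.
have gN (c e : R) : (e <= 0)%R -> (c <= e)%R ->
    \int[lebesgue_measure]_(x in `]c, e]) (g x)%:E = (e - c)%:E.
  move=> e0 ce; rewrite (eq_integral (cst 1)).
    rewrite integral_cst//= mul1e lebesgue_measure_itv/= lte_fin -EFinB.
    by move: ce; rewrite le_eqVlt => /predU1P[->|->]; rewrite ?ltxx ?subrr.
  move=> x; rewrite inE/= in_itv/= => /andP[_ xe].
  by rewrite /g ltNge (le_trans xe e0).
have gP (c e : R) : (0 <= c)%R -> (c <= e)%R ->
    \int[lebesgue_measure]_(x in `]psi c, psi e]) (g x)%:E = (e - c)%:E.
  move=> c0 ce; have e0 := le_trans c0 ce.
  rewrite -[in RHS](psiK c)// -[in RHS](psiK e)//.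
  rewrite -integral_powR_subr1 ?psi0//; last first.
    rewrite /psi; case: (ltP 0%R c) => c1.
      rewrite (lt_le_trans c1 ce).
      by rewrite ge0_ler_powR ?nnegrE// invr_ge0 ltW.
    by rewrite (le_trans c1)// psi0.
  apply: eq_integral => x; rewrite inE/= in_itv/= => /andP[xc _].
  by rewrite /g (le_lt_trans _ xc)// psi0.
have [u0|u0] := leP 0%R u; first by rewrite gP// ltW.
have [v0|v0] := leP v 0%R.
  by rewrite (psiN u (ltW u0)) (psiN v v0) gN// ltW.
(* In the remaining case [u < 0 < v] the interval is cut at 0, where the formula for [phi]
   changes. *)
rewrite (_ : `]psi u, psi v]%classic = `]u, 0%R] `|` `]psi 0%R, psi v])%classic.
  rewrite ge0_integral_setU//=.
  - by rewrite gN ?gP// ?ltW// -EFinD sub0r subr0 addrC.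
  - apply/measurable_EFinP/measurable_funTS.
    apply: measurable_fun_ifT => //; exact: measurable_funM.
  - move=> x _; rewrite lee_fin /g; case: ifP => // _.
    by rewrite mulr_ge0 ?powR_ge0// ltW.
  - apply/disj_setPS => x [] /=; rewrite !in_itv/= psiN//.
    move=> /andP[_ x0] /andP[x1].
    by rewrite ltNge x0 in x1.
rewrite psiN ?(ltW u0)// (psiN 0%R)//.
apply/seteqP; split => x /=; rewrite !in_itv/=.
  by move=> /andP[-> ->]; rewrite andbT/=; case: leP; [left|right].
move=> [/andP[-> x0]|/andP[x0 ->]]/=.
  by rewrite (le_trans x0)// psi0// ltW.
by rewrite andbT (lt_trans u0).
Qed.

End change_of_variables.

(** * The relation between the Gamma and Beta integrals *)

Section beta_gamma.
Context {R : realType}.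
Implicit Types (a b x z : R).

(** The indicator extends the integrand by 0 to the whole line, where shifts and scalings need no
    bookkeeping of domains. *)
Definition gamma_kernel a x : R :=
  x `^ (a - 1) * expR (- x) * \1_`]0%R, +oo[ x.

Definition beta_kernel a b z : R :=
  z `^ (a - 1) * (1 - z) `^ (b - 1) * \1_`]0%R, 1%R[ z.

Lemma gamma_kernel_ge0 a x : 0 <= gamma_kernel a x.
Proof. by rewrite !mulr_ge0 ?powR_ge0 ?expR_ge0. Qed.

Lemma beta_kernel_ge0 a b z : 0 <= beta_kernel a b z.
Proof. by rewrite !mulr_ge0 ?powR_ge0. Qed.

Lemma measurable_gamma_kernel a : measurable_fun setT (gamma_kernel a).
Proof.
apply: measurable_funM; last exact: measurable_indic.
apply: measurable_funM => //.
exact: measurableT_comp.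
Qed.

Lemma measurable_beta_kernel a b : measurable_fun setT (beta_kernel a b).
Proof.
apply: measurable_funM; last exact: measurable_indic.
apply: measurable_funM => //.
by apply: (measurableT_comp (measurable_powR _)); exact: measurable_funB.
Qed.

(** The substitution [x = s * z], with Jacobian [s], separates the variables: the exponentials
    multiply to [expR (- s)], the powers of [s] add up to [a + b - 1], and both Gamma arguments are
    positive exactly when [z] lies in []0, 1[]. *)
Lemma gamma_convolution a b s z : 0 < s ->
  gamma_kernel a (s * z) * gamma_kernel b (s - s * z) * s =
  gamma_kernel (a + b) s * beta_kernel a b z.
Proof.
move=> s0; rewrite /gamma_kernel /beta_kernel.
rewrite !indicE !mem_setE !in_itv/= !andbT s0 mulr1.
rewrite pmulr_rgt0// subr_gt0 gtr_pMr//.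
case: (ltP 0 z) => z0; last by rewrite !(mulr0, mul0r).
case: (ltP z 1) => z1; last by rewrite !(mulr0, mul0r).
rewrite !mulr1 (_ : s - s * z = s * (1 - z)); last by rewrite mulrBr mulr1.
have z10 : 0 < 1 - z by rewrite subr_gt0.
rewrite !powRM ?(ltW s0) ?(ltW z0) ?(ltW z10)//.
have -> : expR (- s) = expR (- (s * z)) * expR (- (s * (1 - z))).
  by rewrite -expRD -opprD -mulrDr addrC subrK mulr1.
have -> : s `^ (a + b - 1) = s `^ (a - 1) * s `^ (b - 1) * s.
  rewrite -[X in _ * X](powRr1 (ltW s0)) -!powRD ?(gt_eqF s0) ?implybT//.
  by congr (_ `^ _); rewrite addrACA addrA subrK.
by ring.
Qed.

Lemma gamma_convolution0 a b s x : s <= 0 ->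
  gamma_kernel a x * gamma_kernel b (s - x) = 0.
Proof.
move=> s0; rewrite /gamma_kernel !indicE !mem_setE !in_itv/= !andbT subr_gt0.
case: (ltP 0 x) => x0; last by rewrite !(mulr0, mul0r).
by rewrite ltNge (le_trans s0 (ltW x0)) !mulr0.
Qed.

Local Open Scope ereal_scope.

(** Both sides compute the double integral of [K]. Integrating in [s] first, a shift by [x] gives
    the left side; after Tonelli, scaling [x] by [s > 0] gives the right side. The identity is
    between extended reals, so no convergence is required. *)
Lemma gamma_mul_gamma a b :
  \int[lebesgue_measure]_x (gamma_kernel a x)%:E *
  \int[lebesgue_measure]_x (gamma_kernel b x)%:E =
  \int[lebesgue_measure]_x (gamma_kernel (a + b) x)%:E *
  \int[lebesgue_measure]_x (beta_kernel a b x)%:E.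
Proof.
pose K (z : measurableTypeR R * measurableTypeR R) :=
  (gamma_kernel a z.1 * gamma_kernel b (z.2 - z.1))%:E.
have mK : measurable_fun setT K.
  apply/measurable_EFinP; apply: measurable_funM.
    apply: (measurableT_comp (measurable_gamma_kernel a)).
    exact: measurable_fst.
  apply: (measurableT_comp (measurable_gamma_kernel b)).
  by apply: measurable_funB; [exact: measurable_snd|exact: measurable_fst].
have K0 (z : measurableTypeR R * measurableTypeR R) : 0 <= K z.
  by rewrite lee_fin mulr_ge0 ?gamma_kernel_ge0.
have mg c : measurable_fun setT (fun x => (gamma_kernel c x)%:E).
  by apply/measurable_EFinP; exact: measurable_gamma_kernel.
have mb : measurable_fun setT (fun x => (beta_kernel a b x)%:E).
  by apply/measurable_EFinP; exact: measurable_beta_kernel.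
have g0 c x : 0 <= (gamma_kernel c x)%:E by rewrite lee_fin gamma_kernel_ge0.
have b0 x : 0 <= (beta_kernel a b x)%:E by rewrite lee_fin beta_kernel_ge0.
transitivity (\int[lebesgue_measure]_x \int[lebesgue_measure]_s K (x, s)).
  rewrite -ge0_integralZr//; [|exact: mg|exact: integral_ge0].
  apply: eq_integral => x _; rewrite /K/=.
  under [RHS]eq_integral do rewrite EFinM.
  rewrite ge0_integralZl//.
    congr (_ * _); rewrite (@integral_affine _ 1 (- x)%R)//.
    by apply: eq_integral => s _; rewrite mul1r mule1.
  apply/measurable_EFinP; apply: (measurableT_comp (measurable_gamma_kernel b)).
  exact: measurable_funB.
transitivity (\int[lebesgue_measure]_s \int[lebesgue_measure]_x K (x, s)).
  exact: fubini_tonelli.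
rewrite -ge0_integralZr//; [|exact: mg|exact: integral_ge0].
apply: eq_integral => s _; have [s0|s0] := ltP 0%R s.
  rewrite (@integral_affine _ s 0%R)//; last first.
    exact: measurableT_comp mK (measurable_pair2 s).
  rewrite -ge0_integralZl//; apply: eq_integral => z _.
  by rewrite -!EFinM addr0/= gamma_convolution.
rewrite [LHS]integral0_eq; last first.
  by move=> x _; rewrite /K/= gamma_convolution0.
by rewrite /gamma_kernel indicE mem_setE in_itv/= ltNge s0 mulr0 mul0e.
Qed.

End beta_gamma.

(** * Integration of stick-breaking products *)

Section stick_breaking.
Context {R : realType}.

(* [r - \sum_(i < j) x_i] is the length remaining after the first [j] pieces
   have been broken off a stick of length [r]. *)
Definition stick_prod n (h : 'I_n -> R -> R) (r : R) (x : n.-tuple R) : R :=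
  \prod_(j < n) ((r - \sum_(i < n | (i < j)%N) tnth x i)^-1 *
    h j (tnth x j / (r - \sum_(i < n | (i < j)%N) tnth x i))).

(** Once a first piece [y] is broken off, the rest is a stick-breaking product for a stick of length
    [r - y]. The inductions below vary [r] for this reason. *)
Lemma stick_prod_cons n (h : 'I_n.+1 -> R -> R) (r y : R) (x : n.-tuple R) :
  stick_prod h r (cons_pair (y, x)) =
  r^-1 * h ord0 (y / r) * stick_prod (fun j => h (lift ord0 j)) (r - y) x.
Proof.
rewrite /stick_prod big_ord_recl big_pred0// subr0; congr (_ * _).
apply: eq_bigr => j _.
have -> : r - \sum_(i < n.+1 | (i < lift ord0 j)%N) tnth (cons_pair (y, x)) i =
    r - y - \sum_(i < n | (i < j)%N) tnth x i.
  rewrite big_mkcond big_ord_recl/= opprD addrA; congr (_ - _ - _).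
  rewrite [RHS]big_mkcond; apply: eq_bigr => i _.
  by rewrite /bump !leq0n !add1n ltnS /cons_pair/= tnthS.
by rewrite /cons_pair/= tnthS.
Qed.

(** A factor [(r - ...)^-1] can be negative only after some ratio has left []0, 1[], and then the
    factor of that ratio already makes the product 0. *)
Lemma stick_prod_ge0 n (h : 'I_n -> R -> R) (r : R) (x : n.-tuple R) :
  (forall j z, 0 <= h j z) -> (forall j z, z \notin `]0, 1[ -> h j z = 0) ->
  0 < r -> 0 <= stick_prod h r x.
Proof.
elim: n h r x => [|n IH] h r x h0 hout r0.
  by rewrite /stick_prod big_ord0.
have -> : x = cons_pair (thead x, [tuple of behead x]) by exact: tuple_eta.
rewrite stick_prod_cons; have [xr|xr] := boolP (thead x / r \in `]0, 1[).
  rewrite !mulr_ge0 ?invr_ge0 ?(ltW r0)//.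
  apply: IH => [//|j z zN|]; first exact: hout.
  by move: xr; rewrite subr_gt0 in_itv/= ltr_pdivrMr// mul1r => /andP[].
by rewrite hout// mulr0 mul0r.
Qed.

(** On [0 <= x] inversion is the power [-1], also at 0, where both are 0 by convention; negative
    arguments follow by oddness. *)
Lemma measurable_invr : measurable_fun setT (@GRing.inv R).
Proof.
rewrite (_ : GRing.inv = fun x : R =>
    if 0 <= x then x `^ (-1) else - ((- x) `^ (-1))); last first.
  apply/funext => x; case: ifPn => x0; first by rewrite powR_inv1.
  by rewrite powR_inv1 ?invrN ?opprK// oppr_ge0 ltW// ltNge.
apply: measurable_fun_ifT => //; first exact: measurable_fun_ler.
apply: measurableT_comp => //.
exact: (measurableT_comp (measurable_powR _)).
Qed.

Lemma measurable_stick_prod n (h : 'I_n -> R -> R) (r : R) :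
  (forall j, measurable_fun setT (h j)) ->
  measurable_fun setT (stick_prod h r).
Proof.
move=> mh; apply: measurable_prod => j _.
have mS : measurable_fun setT
    (fun x : n.-tuple R => (r - \sum_(i < n | (i < j)%N) tnth x i)^-1).
  apply: (measurableT_comp measurable_invr); apply: measurable_funB => //.
  under eq_fun do rewrite big_mkcond.
  by apply: measurable_sum => i; case: (i < j)%N => //; exact: measurable_tnth.
apply: measurable_funM => //; apply: (measurableT_comp (mh j)).
by apply: measurable_funM => //; exact: measurable_tnth.
Qed.

Local Open Scope ereal_scope.

(** By induction, the integral over the later pieces does not depend on the length [r - y] left to
    them. It therefore comes out as a constant, and scaling by [r] turns the integral over the first
    piece into that of [h ord0]. *)
Lemma integral_stick_prod n (h : 'I_n -> R -> R) (r : R) :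
  (forall j, measurable_fun setT (h j)) -> (forall j z, 0 <= h j z)%R ->
  (forall j z, z \notin `]0%R, 1%R[ -> h j z = 0%R) -> (0 < r)%R ->
  \int[tuple_lebesgue n]_x (stick_prod h r x)%:E =
  \prod_(j < n) \int[lebesgue_measure]_z (h j z)%:E.
Proof.
elim: n h r => [|n IH] h r mh h0 hout r0.
  rewrite big_ord0 /= integral_dirac//.
    by rewrite diracT mul1e /stick_prod big_ord0.
  by apply/measurable_EFinP; exact: measurable_stick_prod.
have mf : measurable_fun setT (EFin \o stick_prod h r).
  by apply/measurable_EFinP; exact: measurable_stick_prod.
rewrite big_ord_recl.
transitivity (\int[lebesgue_measure \x tuple_lebesgue n]_z
    (stick_prod h r (cons_pair z))%:E).
  rewrite /= /cons_lebesgue.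
  rewrite (ge0_integral_pushforward (measurable_cons_pair (n := n)))//.
  by move=> x _; rewrite lee_fin stick_prod_ge0.
rewrite fubini_tonelli1//; last 2 first.
- apply: measurableT_comp mf _; exact: measurable_cons_pair.
- by move=> z; rewrite lee_fin stick_prod_ge0.
have mh0 : measurable_fun setT (EFin \o h ord0) by exact/measurable_EFinP.
(* The Jacobian of [y / r] is the factor [r^-1] carried by the first piece. *)
rewrite (@integral_affine _ r^-1 0%R (EFin \o h ord0)) ?invr_gt0//; last first.
  by move=> y; rewrite lee_fin.
have prod0 : 0 <= \prod_(j < n) \int[lebesgue_measure]_z (h (lift ord0 j) z)%:E.
  by apply: prode_ge0 => j _; apply: integral_ge0 => z _; rewrite lee_fin.
have mh0r : measurable_fun setT (fun y => (h ord0 (r^-1 * y + 0))%:E * r^-1%:E).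
  apply: emeasurable_funM => //; apply: measurableT_comp mh0 _.
  by apply: measurable_funD => //; exact: measurable_funM.
rewrite -ge0_integralZr//; last first.
  by move=> y _; apply: mule_ge0; rewrite lee_fin ?h0// invr_ge0 ltW.
apply: eq_integral => y _; rewrite /fubini_F/= addr0.
under eq_integral do rewrite stick_prod_cons EFinM.
(* Off this interval both sides are 0; on it [r - y] is positive, as the induction hypothesis
   demands. *)
have [yr|yr] := boolP (y / r \in `]0, 1[)%R; last first.
  rewrite [(r^-1 * y)%R]mulrC hout// !mul0e.
  by apply: integral0_eq => x _; rewrite mulr0 mul0e.
have ry : (0 < r - y)%R.
  by move: yr; rewrite in_itv/= ltr_pdivrMr// mul1r subr_gt0 => /andP[].
rewrite ge0_integralZl//.
- rewrite IH//; last by move=> j z; exact: hout.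
  by rewrite [(r^-1 * y)%R]mulrC EFinM [X in X * _]muleC.
- by apply/measurable_EFinP; exact: measurable_stick_prod.
- by move=> x _; rewrite lee_fin stick_prod_ge0// => j z; exact: hout.
- by rewrite lee_fin mulr_ge0// invr_ge0 ltW.
Qed.

End stick_breaking.

(** * Canonical coordinates as stick-breaking ratios *)

Section canonical_coordinates.
Context {R : realType} {N : nat}.
Implicit Types (x y : N.-tuple R) (k : nat).

(** The index counts the pieces already removed, so the entry [tnth x j], numbered from 0, is a
    fraction of [remaining x j] and leaves [remaining x j.+1]. *)
Definition remaining x k : R := 1 - \sum_(i < N | (i < k)%N) tnth x i.

Lemma remaining0 x : remaining x 0 = 1.
Proof. by rewrite /remaining big_pred0 ?subr0. Qed.

Lemma remaining_full x : remaining x N = 1 - \sum_(i < N) tnth x i.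
Proof.
by rewrite /remaining; congr (_ - _); apply: eq_bigl => i; rewrite ltn_ord.
Qed.

Lemma remainingS x (j : 'I_N) : remaining x j.+1 = remaining x j - tnth x j.
Proof.
rewrite /remaining (bigD1 j)//= opprD addrA addrAC; congr (_ - _ - _).
by apply: eq_bigl => i; rewrite ltnS [RHS]ltn_neqAle andbC.
Qed.

Lemma remaining_gt0 x k : simplex x -> 0 < remaining x k.
Proof.
move=> [x0 x1]; rewrite subr_gt0; apply: le_lt_trans x1.
rewrite [leRHS](bigID (fun i : 'I_N => (i < k)%N))/= lerDl.
by apply: sumr_ge0 => i _; exact: ltW.
Qed.

Lemma remaining_powRD x k (u v : R) : simplex x ->
  remaining x k `^ (u + v) = remaining x k `^ u * remaining x k `^ v.
Proof. by move=> xS; rewrite powRD// (gt_eqF (remaining_gt0 k xS)) implybT. Qed.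

Lemma pnorm_take_powR (p : R) y k : 1 <= p ->
  pnorm p (take k y) `^ p = \sum_(i < N | (i < k)%N) `|tnth y i| `^ p.
Proof.
move=> p1; have p0 : p != 0 by rewrite gt_eqF// (lt_le_trans _ p1).
rewrite /pnorm -powRrM mulVf// powRr1; last first.
  by apply: sumr_ge0 => i _; exact: powR_ge0.
rewrite (big_nth 0) size_take size_tuple big_mkord -/(minn k N).
rewrite (big_ord_widen_cond N xpredT (fun i => `|nth 0 (take k y) i| `^ p)).
  apply: eq_big => [i|i]; first by rewrite leq_min ltn_ord andbT.
  move=> /andP[_]; rewrite leq_min => /andP[ik _].
  by rewrite nth_take// (tnth_nth 0).
exact: geq_minr.
Qed.

(** Since [|y_i| ^ p = x_i], the denominator is the [p]-th root of [remaining x j], and the root of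
    a quotient is the quotient of the roots. *)
Lemma canonical_coords_signed_root (p : R) x y (s : 'I_N -> R) (j : 'I_N) :
  1 <= p -> simplex x -> (forall i, `|s i| = 1) ->
  (forall i, tnth y i = s i * tnth x i `^ p^-1) ->
  tnth (canonical_coords p y) j =
  s j * (tnth x j / remaining x j) `^ p^-1.
Proof.
move=> p1 xS s1 yE; have p0 : p != 0 by rewrite gt_eqF// (lt_le_trans _ p1).
have x0 i : 0 <= tnth x i by rewrite ltW//; case: xS.
rewrite tnth_mktuple pnorm_take_powR//.
have -> : 1 - \sum_(i < N | (i < j)%N) `|tnth y i| `^ p = remaining x j.
  congr (_ - _); apply: eq_bigr => i _.
  rewrite yE normrM s1 mul1r ger0_norm ?powR_ge0//.
  by rewrite -powRrM mulVf// powRr1.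
have r0 := remaining_gt0 j xS.
rewrite yE powRM ?invr_ge0 ?(ltW r0)// -mulrA; congr (_ * (_ * _)).
rewrite -[(remaining x j)^-1]powR_inv1 ?(ltW r0)// powRAC.
by rewrite powR_inv1 ?powR_ge0.
Qed.

(** This lets [canonical_coords 1], already known to be measurable, stand for the vector of
    stick-breaking ratios. *)
Lemma canonical_coords1 x (j : 'I_N) : simplex x ->
  tnth (canonical_coords 1 x) j = tnth x j / remaining x j.
Proof.
move=> xS; rewrite (@canonical_coords_signed_root 1 x x (fun=> 1))//.
- rewrite mul1r invr1 powRr1// divr_ge0//; last exact/ltW/remaining_gt0.
  by case: xS => x0 _; exact: ltW.
- by move=> _; rewrite normr1.
- by move=> i; rewrite mul1r invr1 powRr1// ltW//; case: xS.
Qed.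

End canonical_coordinates.

(** * The generalized Dirichlet density in stick-breaking form *)

Section generalized_dirichlet.
Context {R : realType} {N : nat}.
Implicit Types (a b x : N.-tuple R) (A : 'I_N -> set R).

(** Restricting the ratios to a box only changes the factors, so [integral_stick_prod] also computes
    probabilities of boxes. *)
Lemma stick_prod_indic (h : 'I_N -> R -> R) A x :
  stick_prod (fun j z => h j z * \1_(A j) z) 1 x =
  stick_prod h 1 x * \prod_(j < N) \1_(A j) (tnth x j / remaining x j).
Proof. by rewrite -big_split; apply: eq_bigr => j _; rewrite /= mulrA. Qed.

(** A nonzero product has all its ratios in []0, 1[]. Starting from length 1, each piece is then
    shorter than what is left, so every remaining length is positive, and hence every piece. *)
Lemma stick_prod_simplex (h : 'I_N -> R -> R) x :
  (forall j z, z \notin `]0, 1[ -> h j z = 0) ->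
  stick_prod h 1 x != 0 -> simplex x.
Proof.
move=> hout /prodf_neq0 neq0.
have ratio j : tnth x j / remaining x j \in `]0, 1[.
  apply: contraT => /hout hj.
  by have := neq0 j isT; rewrite hj mulr0 eqxx.
have rem k : (k <= N)%N -> 0 < remaining x k.
  elim: k => [|k IH] kN; first by rewrite remaining0.
  have rk := IH (ltnW kN).
  have := ratio (Ordinal kN); rewrite in_itv/= => /andP[_].
  by rewrite ltr_pdivrMr// mul1r -subr_gt0 -(remainingS x (Ordinal kN)).
split => [j|]; last by rewrite -subr_gt0 -remaining_full rem.
have rj := rem j (ltnW (ltn_ord j)).
by have := ratio j; rewrite in_itv/= => /andP[+ _];
  rewrite pmulr_lgt0 ?invr_gt0.
Qed.

(** The key is [1 - x_j / r_j = r_(j+1) / r_j], where [r_j] is [remaining x j]. The second product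
    gathers what is to be matched, after an index shift, with the powers [b_(j-1)] of the Dirichlet
    density. *)
Lemma stick_prod_beta_kernel a b x : simplex x ->
  stick_prod (fun j => beta_kernel (tnth a j) (tnth b j)) 1 x =
  (\prod_(j < N) (tnth x j `^ (tnth a j - 1)
     * remaining x j `^ (- (tnth a j + tnth b j)))) *
  \prod_(j < N) (remaining x j.+1 `^ (b`_j - 1) * remaining x j).
Proof.
move=> xS; rewrite -big_split; apply: eq_bigr => j _ /=.
have r0 k := remaining_gt0 k xS.
have x0 : 0 < tnth x j by case: xS.
have rN0 : remaining x j != 0 by rewrite gt_eqF.
rewrite -/(remaining x j) /beta_kernel indicE mem_setE in_itv/= divr_gt0//.
rewrite ltr_pdivrMr// mul1r -subr_gt0 -remainingS r0 mulr1.
have -> : 1 - tnth x j / remaining x j = remaining x j.+1 / remaining x j.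
  by rewrite remainingS mulrBl divff.
rewrite !powRM ?invr_ge0 ?(ltW (r0 _)) ?(ltW x0)//.
rewrite -(powR_inv1 (ltW (r0 j))) -!powRrM !mulN1r -(tnth_nth 0 b).
(* The four summands are the exponents of [remaining x j]: from the leading inverse, from the two
   ratios, and a final [-1] that cancels the factor [remaining x j] on the right. *)
have -> : - (tnth a j + tnth b j) =
    -1 + - (tnth a j - 1) + (- (tnth b j - 1) + -1) by ring.
rewrite !(remaining_powRD j _ _ xS) powR_inv1 ?(ltW (r0 _))//.
by field.
Qed.

Lemma gd_densityE a b x : (0 < N)%N -> gd_density a b x =
  (gd_norm a b)^-1 *
  stick_prod (fun j => beta_kernel (tnth a j) (tnth b j)) 1 x.
Proof.
move=> N0; rewrite /gd_density indicE.
have [xS|xS] := boolP (x \in simplex); last first.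
  rewrite mulr0; apply/esym/eqP; rewrite mulf_eq0; apply/orP; right.
  apply: contraNT xS => neq0; rewrite inE; apply: stick_prod_simplex neq0.
  by move=> j z z01; rewrite /beta_kernel indicE mem_setE (negbTE z01) mulr0.
rewrite inE in xS; rewrite mulr1 -!mulrA; congr (_ * _).
rewrite stick_prod_beta_kernel// -remaining_full.
have r0 k := remaining_gt0 k xS.
transitivity (remaining x N `^ (b`_N.-1 - 1) *
    ((\prod_(j < N) (tnth x j `^ (tnth a j - 1)
       * remaining x j `^ (- (tnth a j + tnth b j)))) *
     \prod_(j < N) remaining x j `^ b`_j.-1)).
  rewrite -big_split; congr (_ * _); apply: eq_bigr => j _ /=.
  by rewrite -/(remaining x j) [b`_j.-1 - _]addrC remaining_powRD// mulrA.
rewrite mulrCA; congr (_ * _).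
(* The factor [j = 0] has base 1 and the last power of [remaining x N] is split off. The other
   factors match after a shift by one, because [r ^ (b - 1) * r = r ^ b]. *)
case: N N0 a b x xS r0 => // n _ a b x xS r0.
rewrite big_split/= big_ord_recl remaining0 powR1 mul1r.
rewrite [X in _ = X * _]big_ord_recr/=.
rewrite [X in _ = _ * X]big_ord_recl remaining0 mul1r.
rewrite [RHS]mulrAC mulrC; congr (_ * _).
rewrite -big_split/=; apply: eq_bigr => j _.
rewrite -[b`_(0 + j)](subrK 1) remaining_powRD//=.
by rewrite subrK powRr1// ltW.
Qed.

End generalized_dirichlet.

(** * The normalised Beta law *)

Section beta_law.
Context {R : realType}.
Implicit Types (a b : R) (A : set R).

Lemma Gamma_ge0 a : 0 <= Gamma a.
Proof.
by apply: Rintegral_ge0 => // t _; rewrite mulr_ge0 ?powR_ge0 ?expR_ge0.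
Qed.

(* A divergent Gamma integral would be collapsed to the junk value 0. *)
Lemma Gamma_gamma_kernel a : Gamma a != 0 ->
  (Gamma a)%:E = (\int[lebesgue_measure]_x (gamma_kernel a x)%:E)%E.
Proof.
move=> Ga.
have -> : (\int[lebesgue_measure]_x (gamma_kernel a x)%:E =
    \int[lebesgue_measure]_(t in `]0%R, +oo[) (t `^ (a - 1) * expR (- t))%:E)%E.
  rewrite [RHS]integral_mkcond; apply: eq_integral => x _.
  rewrite patchE /gamma_kernel indicE.
  by case: ifPn => _; rewrite ?mulr1 ?mulr0.
move: Ga; rewrite /Gamma /Rintegral.
case: (integral _ _ _) => [r _| |]//=; by rewrite eqxx.
Qed.

(** This is the Beta function B(a, b). As [0^-1 = 0], it is nonzero only if all three Gamma values
    are, so a single condition rules out every divergent case. *)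
Definition beta_norm a b : R := Gamma a * Gamma b / Gamma (a + b).

Lemma integral_beta_kernel a b : beta_norm a b != 0 ->
  (\int[lebesgue_measure]_x (beta_kernel a b x)%:E = (beta_norm a b)%:E)%E.
Proof.
rewrite !mulf_eq0 invr_eq0 !negb_or -andbA => /and3P[Ga Gb Gab].
have := gamma_mul_gamma a b; rewrite -!Gamma_gamma_kernel//.
case: (integral _ _ _) => [r| |].
- by rewrite -!EFinM => -[E]; rewrite /beta_norm E mulrAC divff ?mul1r.
(* An infinite Beta integral, times the positive [Gamma (a + b)], could not equal the finite product
   of Gamma values. *)
- by rewrite mulry gtr0_sg ?mul1e// lt0r Gab Gamma_ge0.
- by rewrite mulrNy gtr0_sg ?mul1e// lt0r Gab Gamma_ge0.
Qed.

Definition beta_law a b A : \bar R :=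
  (\int[lebesgue_measure]_z
    ((beta_norm a b)^-1 * (beta_kernel a b z * \1_A z))%:E)%E.

Lemma beta_density_ge0 a b A z :
  0 <= (beta_norm a b)^-1 * (beta_kernel a b z * \1_A z).
Proof.
apply: mulr_ge0; last by rewrite mulr_ge0// beta_kernel_ge0.
by rewrite invr_ge0 mulr_ge0 ?invr_ge0 ?mulr_ge0 ?Gamma_ge0.
Qed.

Lemma measurable_beta_density a b A : measurable A ->
  measurable_fun setT
    (fun z => (beta_norm a b)^-1 * (beta_kernel a b z * \1_A z)).
Proof.
move=> mA; apply: measurable_funM => //; apply: measurable_funM => //.
exact: measurable_beta_kernel.
Qed.

Lemma beta_law_ge0 a b A : (0 <= beta_law a b A)%E.
Proof. by apply: integral_ge0 => z _; rewrite lee_fin beta_density_ge0. Qed.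

Lemma le_beta_law a b A B : measurable A -> measurable B -> A `<=` B ->
  (beta_law a b A <= beta_law a b B)%E.
Proof.
move=> mA mB AB; apply: ge0_le_integral => //.
- by move=> z _; rewrite lee_fin beta_density_ge0.
- by apply/measurable_EFinP; exact: measurable_beta_density.
- by apply/measurable_EFinP; exact: measurable_beta_density.
move=> z _; rewrite lee_fin; have [Az|Az] := pselect (A z).
  by rewrite !indicE !mem_set//; exact: AB.
by rewrite [\1_A z]indicE memNset// !mulr0 beta_density_ge0.
Qed.

Lemma beta_lawE a b A : measurable A -> beta_norm a b != 0 ->
  beta_law a b A = ((beta_norm a b)^-1%:E *
    \int[lebesgue_measure]_z (beta_kernel a b z * \1_A z)%:E)%E.
Proof.
move=> mA nab; rewrite /beta_law.
under eq_integral do rewrite EFinM.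
rewrite ge0_integralZl_EFin//.
- by move=> x _; rewrite lee_fin mulr_ge0// beta_kernel_ge0.
- apply/measurable_EFinP; apply: measurable_funM => //.
  exact: measurable_beta_kernel.
- by rewrite invr_ge0 mulr_ge0 ?invr_ge0 ?mulr_ge0 ?Gamma_ge0.
Qed.

End beta_law.

(** * Independence and Beta laws of the ratios of a generalized Dirichlet vector *)

Lemma measurable_simplex (R : realType) (N : nat) :
  measurable (simplex : set (N.-tuple R)).
Proof.
rewrite (_ : simplex = (\bigcap_(i in [set: 'I_N])
    ((fun x : N.-tuple R => tnth x i) @^-1` `]0, +oo[)) `&`
    ((fun x : N.-tuple R => \sum_(i < N) tnth x i) @^-1` `]-oo, 1[)); last first.
  apply/seteqP; split => x [x0 x1]; split => [i|].
  - by move=> _; rewrite /= in_itv/= x0.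
  - by rewrite /= in_itv.
  - by have := x0 i Logic.I; rewrite /= in_itv/= andbT.
  - by move: x1; rewrite /= in_itv.
apply: measurableI.
  apply: fin_bigcap_measurable => // i _.
  by rewrite -[X in measurable X]setTI; exact: measurable_tnth.
rewrite -[X in measurable X]setTI.
suff m : measurable_fun setT (fun x : N.-tuple R => \sum_(i < N) tnth x i) by exact: m.
by apply: measurable_sum => i; exact: measurable_tnth.
Qed.

Section gd_distributed.
Context {R : realType} {N : nat} (a b : N.-tuple R).
Context d (T : measurableType d) (Q : probability T R).
Context (rho : {RV Q >-> N.-tuple R}).
Hypotheses (N0 : (0 < N)%N) (gd_rho : gd_distributed Q rho a b).

Lemma gd_norm_ge0 : 0 <= gd_norm a b.
Proof.
by apply: prodr_ge0 => j _; rewrite mulr_ge0 ?invr_ge0 ?mulr_ge0 ?Gamma_ge0.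
Qed.

Let Zset (A : 'I_N -> set R) : set (N.-tuple R) :=
  [set x | forall j, A j (tnth (canonical_coords 1 x) j)].

Let measurable_Zset A : (forall j, measurable (A j)) -> measurable (Zset A).
Proof.
move=> mA; rewrite (_ : Zset A = \bigcap_(j in [set: 'I_N])
    ((fun x => tnth (canonical_coords 1 x) j) @^-1` A j)); last first.
  by apply/seteqP; split => x /= H j; [move=> _; exact: H|exact: (H j)].
apply: fin_bigcap_measurable => // j _.
rewrite -[X in measurable X]setTI.
apply: (measurableT_comp (measurable_tnth j)) => //.
Qed.

(** The kernels are left unnormalised and the constant is kept in front, because no normalising
    constant is known to be nonzero at this stage. *)
Let gd_kernel A :
  (forall j, measurable (A j)) ->
  Q [set t | forall j, A j (tnth (canonical_coords 1 (rho t)) j)] =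
  ((gd_norm a b)^-1%:E * \prod_(j < N)
    \int[lebesgue_measure]_z
      (beta_kernel (tnth a j) (tnth b j) z * \1_(A j) z)%:E)%E.
Proof.
move=> mA; have mZ := measurable_Zset mA.
have out j z : z \notin `]0, 1[ ->
    beta_kernel (tnth a j) (tnth b j) z * \1_(A j) z = 0.
  by move=> z01; rewrite /beta_kernel indicE mem_setE (negbTE z01) mulr0 mul0r.
have m1 j : measurable_fun setT
    (fun z => beta_kernel (tnth a j) (tnth b j) z * \1_(A j) z).
  by apply: measurable_funM => //; exact: measurable_beta_kernel.
have ge0 j z : 0 <= beta_kernel (tnth a j) (tnth b j) z * \1_(A j) z.
  by rewrite mulr_ge0// beta_kernel_ge0.
rewrite -[LHS]/(distribution Q rho (Zset A)) gd_rho//.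
rewrite -(@integral_stick_prod _ _ (fun j z =>
  beta_kernel (tnth a j) (tnth b j) z * \1_(A j) z) 1)//.
rewrite -ge0_integralZl_EFin ?invr_ge0 ?gd_norm_ge0//.
- rewrite [LHS]integral_mkcond; apply: eq_integral => x _.
  rewrite -EFinM stick_prod_indic patchE gd_densityE//; have [xS|xS] := pselect (simplex x); last first.
    have -> : stick_prod (fun j => beta_kernel (tnth a j) (tnth b j)) 1 x = 0.
      apply/eqP; apply: contra_notT xS; apply: stick_prod_simplex => j z z01.
      by rewrite /beta_kernel indicE mem_setE (negbTE z01) mulr0.
    by rewrite mul0r mulr0; case: ifP.
  under eq_bigr do rewrite -canonical_coords1//.
  case: ifPn => [|xZ].
    rewrite inE => xZ; rewrite big1 ?mulr1// => j _.
    by rewrite indicE mem_set.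
  (* Outside the box one indicator factor vanishes, and with it the product. *)
  have [j xj] : exists j, ~ A j (tnth (canonical_coords 1 x) j).
    by apply/existsNP => H; move: xZ; rewrite notin_setE; exact.
  by rewrite (bigD1 j)//= indicE memNset// mul0r !mulr0.
- by move=> x _; rewrite lee_fin stick_prod_ge0.
- by apply/measurable_EFinP; exact: measurable_stick_prod.
Qed.

(** Taking every set to be the whole line in [gd_kernel] gives total mass 1, which the factor
    [(gd_norm a b)^-1] would reduce to 0 if [gd_norm a b] were 0. Its factors are the [beta_norm]
    values. *)
Lemma gd_beta_norm_neq0 j : beta_norm (tnth a j) (tnth b j) != 0.
Proof.
have : gd_norm a b != 0.
  have := @gd_kernel (fun=> setT) (fun=> measurableT).
  rewrite (_ : [set t | _] = setT); last by apply/seteqP; split.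
  rewrite probability_setT; apply: contra_eqN => /eqP ->.
  by rewrite invr0 mul0e onee_neq0.
by move/prodf_neq0 => /(_ j isT).
Qed.

Lemma gd_law A : (forall j, measurable (A j)) ->
  Q [set t | forall j, A j (tnth (canonical_coords 1 (rho t)) j)] =
  (\prod_(j < N) beta_law (tnth a j) (tnth b j) (A j))%E.
Proof.
move=> mA; rewrite gd_kernel//.
under [RHS]eq_bigr do rewrite beta_lawE ?gd_beta_norm_neq0//.
rewrite big_split/=; congr (_ * _)%E.
by rewrite prodEFin prodfV.
Qed.

Lemma gd_beta_law_setT j : beta_law (tnth a j) (tnth b j) setT = 1%E.
Proof.
rewrite beta_lawE ?gd_beta_norm_neq0//.
under eq_integral do rewrite indicT mulr1.
rewrite integral_beta_kernel ?gd_beta_norm_neq0// -EFinM mulVf//.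
exact: gd_beta_norm_neq0.
Qed.

Lemma gd_beta_law_fin_num j (A : set R) : measurable A ->
  beta_law (tnth a j) (tnth b j) A \is a fin_num.
Proof.
move=> mA; rewrite ge0_fin_numE; last by exact: beta_law_ge0.
rewrite (le_lt_trans (le_beta_law _ _ mA measurableT _))//.
by rewrite gd_beta_law_setT ltry.
Qed.

Lemma gd_simplex : Q [set t | ~ simplex (rho t)] = 0%E.
Proof.
rewrite -[LHS]/(distribution Q rho (~` simplex)) gd_rho; last first.
  by apply: measurableC; exact: measurable_simplex.
apply: integral0_eq => x xS.
by rewrite /gd_density indicE memNset// mulr0.
Qed.

End gd_distributed.

(** * The density of a randomly signed root of a Beta variable *)

Section signed_root_law.
Context {R : realType}.
Implicit Types (p a b x : R) (A : set R).

Definition signed_root_density p a b x : R :=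
  p * Gamma (a + b) / (2 * Gamma a * Gamma b)
  * `|x| `^ (p * a - 1) * (1 - `|x| `^ p) `^ (b - 1)
  * \1_`]-1, 1[ x.

Lemma signed_root_density_ge0 p a b x : 0 <= p ->
  0 <= signed_root_density p a b x.
Proof.
by move=> p0; rewrite !mulr_ge0 ?powR_ge0 ?invr_ge0 ?mulr_ge0 ?Gamma_ge0.
Qed.

Lemma measurable_signed_root_density p a b :
  measurable_fun setT (signed_root_density p a b).
Proof.
apply: measurable_funM; last exact: measurable_indic.
apply: measurable_funM.
  apply: measurable_funM => //.
  exact: (measurableT_comp (measurable_powR _)).
apply: (measurableT_comp (measurable_powR _)); apply: measurable_funB => //.
exact: (measurableT_comp (measurable_powR _)).
Qed.

Lemma measurable_scale_root (s p : R) :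
  measurable_fun setT (fun z : R => s * z `^ p^-1).
Proof. exact: measurable_funM. Qed.

(** The factor [2^-1] is the probability of one sign, and [p * x ^ (p - 1)] is the Jacobian of
    [z = x ^ p]. *)
Lemma signed_root_densityE p a b x : 1 <= p -> beta_norm a b != 0 -> 0 < x ->
  2^-1 * ((beta_norm a b)^-1 * beta_kernel a b (x `^ p)) * (p * x `^ (p - 1)) =
  signed_root_density p a b x.
Proof.
move=> p1 nab x0; rewrite /signed_root_density /beta_kernel.
rewrite !indicE !mem_setE !in_itv/=.
have p0 : 0 < p by exact: lt_le_trans p1.
rewrite powR_gt0// (lt_trans _ x0) ?ltrN10//= gtr0_norm//.
have -> : (x `^ p < 1) = (x < 1).
  have {1}<- : 1 `^ p = 1 :> R by rewrite powR1.
  apply/idP/idP; last first.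
    by apply: gt0_ltr_powR; rewrite ?nnegrE// ltW.
  apply: contraTT; rewrite -!leNgt.
  by apply: ge0_ler_powR; rewrite ?nnegrE// ltW.
have -> : x `^ (p * a - 1) = x `^ p `^ (a - 1) * x `^ (p - 1).
  by rewrite -powRrM -powRD ?(gt_eqF x0) ?implybT//; congr (_ `^ _); ring.
move: nab; rewrite /beta_norm !mulf_eq0 invr_eq0 !negb_or -andbA.
move=> /and3P[Ga Gb Gab].
by field; rewrite Ga Gb Gab.
Qed.

Local Open Scope ereal_scope.

Lemma beta_law_root (s p a b : R) A : (1 <= p)%R -> beta_norm a b != 0%R ->
  measurable A ->
  (2^-1)%:E * beta_law a b ((fun z : R => s * z `^ p^-1) @^-1` A)%R =
  \int[lebesgue_measure]_(x in `]0%R, +oo[)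
    (signed_root_density p a b x * \1_A (s * x)%R)%:E.
Proof.
move=> p1 nab mA; have p0 : (0 < p)%R by exact: lt_le_trans p1.
have mpre : measurable ((fun z : R => s * z `^ p^-1) @^-1` A)%R.
  by rewrite -[X in measurable X]setTI; exact: measurable_scale_root.
pose f z := ((beta_norm a b)^-1 *
  (beta_kernel a b z * \1_((fun z : R => s * z `^ p^-1) @^-1` A) z))%:E%R.
have m1 : measurable_fun setT f.
  by apply/measurable_EFinP; exact: measurable_beta_density.
have ge0 z : 0 <= f z by rewrite lee_fin beta_density_ge0.
rewrite -[beta_law _ _ _]/(\int[lebesgue_measure]_z f z).
rewrite (integral_powR p1 m1 ge0); last first.
  move=> z z0; rewrite /f /beta_kernel [\1_`]_, _[ _]indicE mem_setE in_itv/=.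
  by rewrite ltNge z0/= !(mulr0, mul0r).
rewrite -ge0_integralZl_EFin//.
- apply: eq_integral => x; rewrite inE/= in_itv/= andbT => x0.
  rewrite -!EFinM -(signed_root_densityE p1 nab x0); congr EFin.
  have -> : \1_((fun z : R => s * z `^ p^-1) @^-1` A)%R (x `^ p)%R = \1_A (s * x)%R :> R.
    have xpK : ((x `^ p) `^ p^-1 = x)%R.
      by rewrite -powRrM divff ?gt_eqF// powRr1// ltW.
    by rewrite !indicE -[in RHS]xpK.
  by ring.
- by move=> x _; rewrite mule_ge0// lee_fin mulr_ge0 ?powR_ge0// ltW.
- apply: measurable_funTS; apply: emeasurable_funM.
    exact: (measurableT_comp m1 (measurable_powR _)).
  by apply/measurable_EFinP; exact: measurable_funM.
Qed.

(** The sign 1 accounts for the positive half-line and the sign -1, after a reflection, for the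
    negative one, the density being even. The point 0 is negligible. *)
Lemma beta_law_mixture (p a b : R) A : (1 <= p)%R -> beta_norm a b != 0%R ->
  measurable A ->
  (2^-1)%:E * beta_law a b ((fun z : R => 1 * z `^ p^-1) @^-1` A)%R +
  (2^-1)%:E * beta_law a b ((fun z : R => -1 * z `^ p^-1) @^-1` A)%R =
  \int[lebesgue_measure]_(x in A) (signed_root_density p a b x)%:E.
Proof.
move=> p1 nab mA; rewrite !beta_law_root//.
have p0 : (0 <= p)%R by exact: le_trans p1.
pose F x := (signed_root_density p a b x * \1_A x)%:E.
have mF : measurable_fun setT F.
  apply/measurable_EFinP; apply: measurable_funM => //.
  exact: measurable_signed_root_density.
have F0 x : 0 <= F x by rewrite lee_fin mulr_ge0// signed_root_density_ge0.
have -> : \int[lebesgue_measure]_(x in A) (signed_root_density p a b x)%:E =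
    \int[lebesgue_measure]_x F x.
  rewrite integral_mkcond; apply: eq_integral => x _.
  by rewrite patchE /F indicE; case: ifP; rewrite ?mulr1 ?mulr0.
rewrite (_ : setT = `[0%R, +oo[ `|` `]-oo, 0%R[)%classic; last first.
  apply/seteqP; split => x //= _; rewrite !in_itv/= andbT.
  by case: (leP 0%R x); [left|right].
rewrite ge0_integral_setU//=; last 2 first.
  exact: measurable_funTS.
  apply/disj_setPS => x [] /=; rewrite !in_itv/= andbT => x0.
  by rewrite ltNge x0.
congr (_ + _).
  rewrite -integral_itv_obnd_cbnd; last exact: measurable_funTS.
  by apply: eq_integral => x _; rewrite mul1r.
have -> : \int[lebesgue_measure]_(x in `]0%R, +oo[)
      (signed_root_density p a b x * \1_A (-1 * x)%R)%:E =
    \int[lebesgue_measure]_(x in `]0%R, +oo[) F (- x)%R.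
  apply: eq_integral => x _; congr (_ * _)%:E; last by rewrite mulN1r.
  rewrite /signed_root_density normrN !indicE !mem_setE !in_itv/=.
  by rewrite ltrN2 (ltrNl x) andbC.
rewrite integral_mkcond integral_oppr.
- rewrite [RHS]integral_mkcond; apply: eq_integral => x _.
  by rewrite !patchE !mem_setE !in_itv/= andbT oppr_gt0 opprK.
- apply/(measurable_restrictT _ _).1 => //.
  by apply: measurable_funTS; exact: measurableT_comp.
- by move=> x; rewrite patchE; case: ifP.
Qed.

End signed_root_law.

(** * Events of full probability, finite partitions and marginals *)

Section full_events.
Context d (T : measurableType d) (R : realType) (Q : probability T R).

Lemma eq_measure_full (G A B : set T) : measurable G -> measurable A ->
  measurable B -> Q (~` G) = 0%E -> A `&` G = B `&` G -> Q A = Q B.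
Proof.
move=> mG mA mB QG AB; have QD E : measurable E -> Q E = Q (E `&` G).
  move=> mE; rewrite (measureDI Q mE mG) [X in (X + _)%E](_ : _ = 0%E) ?add0e//.
  apply: subset_measure0 QG; [exact: measurableD|exact: measurableC|].
  by move=> t [].
by rewrite QD// AB -QD.
Qed.

Lemma measurable_ord_preimages n (U : measurableType default_measure_display)
    (X : 'I_n -> T -> U) (A : 'I_n -> set U) :
  (forall j, measurable_fun setT (X j)) -> (forall j, measurable (A j)) ->
  measurable [set t | forall j, A j (X j t)].
Proof.
move=> mX mA; rewrite (_ : mkset _ = \bigcap_(j in [set: 'I_n]) X j @^-1` A j).
  apply: fin_bigcap_measurable => // j _.
  by rewrite -[X in measurable X]setTI; exact: mX.
by apply/seteqP; split => t /= H j; [move=> _; exact: H|exact: (H j)].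
Qed.

Lemma measure_fin_partition (I : finType) (F : I -> set T) :
  (forall i, measurable (F i)) -> trivIset setT F ->
  Q (\bigcup_i F i) = (\sum_(i : I) Q (F i))%E.
Proof.
move=> mF tF; rewrite (measure_fin_bigcup Q finite_finset tF (fun i _ => mF i)).
rewrite [RHS]fsbig_seq ?index_enum_uniq//; apply: eq_fsbigl.
by apply/seteqP; split => i //= _; rewrite mem_index_enum.
Qed.

(** In the joint law, all sets but the [j]-th are taken to be [setT], whose factors are 1. *)
Lemma marginal_of_joint n (U : measurableType default_measure_display)
    (X : 'I_n -> T -> U) (nu : 'I_n -> set U -> \bar R) :
  (forall A : 'I_n -> set U, (forall j, measurable (A j)) ->
    Q [set t | forall j, A j (X j t)] = (\prod_(j < n) nu j (A j))%E) ->
  (forall j, nu j setT = 1%E) ->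
  forall j A, measurable A -> Q (X j @^-1` A) = nu j A.
Proof.
move=> joint nuT j A mA.
have /joint : forall i : 'I_n, measurable (if i == j then A else setT).
  by move=> i; case: ifP.
rewrite (bigD1 j)//= eqxx big1 ?mule1 => [<-|i /negbTE ->]; last exact: nuT.
congr (Q _); apply/seteqP; split => t /= H; last by have := H j; rewrite eqxx.
by move=> i; case: eqP => // ->.
Qed.

End full_events.

(** * Joint law of the canonical coordinates of the signed roots *)

Section canonical_coordinates_law.
Context {R : realType} {N : nat} (p : R) (a b : N.-tuple R).
Context d (T : measurableType d) (Q : probability T R).
Context (eps rho : {RV Q >-> N.-tuple R}).
Hypotheses (N0 : (0 < N)%N) (p1 : 1 <= p).
Hypothesis gd_rho : gd_distributed Q rho a b.
Hypothesis rad_eps : forall i, rademacher Q (rv_coord eps i).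
Hypothesis ind_eps : mutual_independent Q (fun i => rv_coord eps i).
Hypothesis ind_eps_rho : independent_pair Q eps rho.

(** On the simplex [Z j] is the [j]-th stick-breaking ratio of [rho]. [W j] agrees almost surely
    with the [j]-th canonical coordinate of the signed roots. *)
Let Z (j : 'I_N) : {RV Q >-> R} := rv_coord (canonical_coords 1 \o rho) j.
Let W (j : 'I_N) : {RV Q >-> R} := signed_root p (rv_coord eps j) (Z j).

Let sgn (s : bool) : R := if s then 1 else -1.

Let N11 : (-1 == 1 :> R) = false.
Proof. by apply/negP => /eqP; lra. Qed.

Let signs := [set t | forall j, [set 1; -1] (tnth (eps t) j)].

Let measurable_signs : measurable signs.
Proof.
apply: (@measurable_ord_preimages _ _ _ _ (fun j t => tnth (eps t) j)
  (fun=> [set 1; -1])) => j.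
  exact: (measurableT_comp (measurable_tnth j)).
exact: measurableU.
Qed.

(** The two masses [2^-1] exhaust the probability, so each entry of [eps] is almost surely a sign;
    finitely many null events are then put together. *)
Let signs_full : Q (~` signs) = 0%E.
Proof.
have m1 j : measurable (rv_coord eps j @^-1` [set 1; -1]).
  rewrite -[X in measurable X]setTI; apply: measurable_funPT => //.
  exact: measurableU.
have sign1 j : Q (~` (rv_coord eps j @^-1` [set 1; -1])) = 0%E.
  rewrite probability_setC// preimage_setU measureU.
  - rewrite [X in (1 - (X + _))%E](rad_eps j).1 [X in (1 - (_ + X))%E](rad_eps j).2.
    have half2 : 2^-1 + 2^-1 = 1 :> R by lra.
    by rewrite -EFinD half2 subrr.
  - by rewrite -[X in measurable X]setTI; exact: measurable_funPT.
  - by rewrite -[X in measurable X]setTI; exact: measurable_funPT.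
  - apply/seteqP; split => // t /= [->] /eqP.
    by rewrite eq_sym N11.
(* The finite family is padded with empty sets to a sequence, to which countable subadditivity
   applies. *)
pose F n := if insub n is Some j then
  ~` (rv_coord eps j @^-1` [set 1; -1]) else set0.
have subF : ~` signs `<=` \bigcup_n F n.
  move=> t /existsNP[j tj]; exists (val j) => //; rewrite /F.
  by case: insubP => [i _ /val_inj ->|]; rewrite ?ltn_ord.
have [M [mM M0 FM]] : Q.-negligible (\bigcup_n F n).
  apply: negligible_bigcup => n; rewrite /F; case: insubP => [j _ _|_].
    by apply/negligibleP; [apply: measurableC; exact: m1|exact: sign1].
  exact: negligible_set0.
apply: subset_measure0 M0 => //; first exact: measurableC.
exact: subset_trans FM.
Qed.

(** With the sign pattern fixed, the event is a condition on [eps] and one on [rho], which are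
    independent. Independent signs give [2^-1] each, and [gd_law] gives the Beta factors. *)
Let sign_joint (s : {ffun 'I_N -> bool}) (B : 'I_N -> set R) :
  (forall j, measurable (B j)) ->
  Q [set t | forall j, tnth (eps t) j = sgn (s j) /\ B j (Z j t)] =
  (\prod_(j < N) ((2^-1)%:E * beta_law (tnth a j) (tnth b j) (B j)))%E.
Proof.
move=> mB.
pose E := [set e : N.-tuple R | forall j, [set sgn (s j)] (tnth e j)].
pose F := [set x : N.-tuple R | forall j, B j (tnth (canonical_coords 1 x) j)].
have mE : measurable E.
  apply: (@measurable_ord_preimages _ _ _ _ (fun j e => tnth e j)
    (fun j => [set sgn (s j)])) => // j; exact: measurable_tnth.
have mF : measurable F.
  apply: (@measurable_ord_preimages _ _ _ _
    (fun j x => tnth (canonical_coords 1 x) j)) => // j.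
  exact: (measurableT_comp (measurable_tnth j)).
have -> : [set t | forall j, tnth (eps t) j = sgn (s j) /\ B j (Z j t)] =
    eps @^-1` E `&` rho @^-1` F.
  apply/seteqP; split => [t H|t [H1 H2] j]; last by split; [exact: H1|exact: H2].
  by split=> j; [exact: (H j).1|exact: (H j).2].
rewrite ind_eps_rho// big_split; congr (_ * _)%E; last exact: gd_law.
have := ind_eps [set: 'I_N]%SET (fun j => measurable_set1 (sgn (s j))).
rewrite (_ : \bigcap_(i in _) _ = eps @^-1` E); last first.
  apply/seteqP; split => t /= H j; last by move=> _; exact: H.
  by apply: H => /=; rewrite finset.inE.
move=> ->; apply: eq_big => [j|j _]; first by rewrite finset.inE.
by have [H1 HN1] := rad_eps j; case: (s j).
Qed.

(** Up to a null event, the event is the disjoint union over all sign patterns [s] of the events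
    [E s], whose probabilities are known from [sign_joint]. *)
Let joint_W A : (forall j, measurable (A j)) ->
  Q [set t | forall j, A j (W j t)] = (\prod_(j < N)
    \int[lebesgue_measure]_(x in A j)
      (signed_root_density p (tnth a j) (tnth b j) x)%:E)%E.
Proof.
move=> mA.
pose pre s A := (fun z : R => sgn s * z `^ p^-1) @^-1` A.
have mpre s A0 : measurable A0 -> measurable (pre s A0).
  by move=> ?; rewrite -[X in measurable X]setTI; exact: measurable_scale_root.
pose E (s : {ffun 'I_N -> bool}) :=
  [set t | forall j, tnth (eps t) j = sgn (s j) /\ pre (s j) (A j) (Z j t)].
have mE s : measurable (E s).
  rewrite (_ : E s = [set t | forall j, [set sgn (s j)] (tnth (eps t) j)] `&`
      [set t | forall j, pre (s j) (A j) (Z j t)]); last first.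
    apply/seteqP; split => [t H|t [H1 H2] j]; last by split; [exact: H1|exact: H2].
    by split=> j; [exact: (H j).1|exact: (H j).2].
  apply: measurableI; last first.
    apply: (@measurable_ord_preimages _ _ _ _ (fun j t => Z j t)
      (fun j => pre (s j) (A j))) => j; [exact: measurable_funPT|exact: mpre].
  apply: (@measurable_ord_preimages _ _ _ _ (fun j t => tnth (eps t) j)
    (fun j => [set sgn (s j)])) => // j.
  exact: (measurableT_comp (measurable_tnth j)).
have tE : trivIset setT E.
  move=> s u _ _ [t [Es Eu]]; apply/ffunP => j.
  have := (Es j).1; rewrite (Eu j).1 /sgn; case: (s j) (u j) => -[]// /eqP;
    by rewrite ?N11// eq_sym ?N11.
have mW : measurable [set t | forall j, A j (W j t)].
  by apply: measurable_ord_preimages.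
rewrite (@eq_measure_full _ _ _ Q signs _ (\bigcup_s E s))//; last 2 first.
  by apply: fin_bigcup_measurable => // s _; exact: mE.
  apply/seteqP; split => t [H G]; split=> //.
    (* The pattern is read off from [eps t], whose entries are 1 or -1 on [signs]. *)
    exists [ffun j => tnth (eps t) j == 1] => // j; rewrite /pre ffunE /sgn.
    have := H j; rewrite /W/= /signed_root/=.
    have -> : rv_coord eps j t = tnth (eps t) j by [].
    by have [->|->] := G j; rewrite ?eqxx ?N11.
  case: H => s _ Es j; have [Ej Aj] := Es j; rewrite /W/= /signed_root.
  by have -> : rv_coord eps j t = sgn (s j) by [].
rewrite measure_fin_partition//.
(* The finite factors are moved to the reals, whose ring structure allows a product of sums to be
   expanded. *)
pose q j s0 := fine ((2^-1)%:E * beta_law (tnth a j) (tnth b j) (pre s0 (A j)))%E.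
have qE j s0 : (q j s0)%:E =
    ((2^-1)%:E * beta_law (tnth a j) (tnth b j) (pre s0 (A j)))%E.
  by rewrite /q fineK// fin_numM// (gd_beta_law_fin_num N0 gd_rho) //; exact: mpre.
transitivity (\sum_(s : {ffun 'I_N -> bool}) (\prod_(j < N) q j (s j))%:E)%E.
  apply: eq_bigr => s _; rewrite -prodEFin.
  transitivity (\prod_(j < N) ((2^-1)%:E *
      beta_law (tnth a j) (tnth b j) (pre (s j) (A j))))%E.
    by apply: sign_joint => j; exact: mpre.
  by apply: eq_bigr => j _; rewrite qE.
(* The sum over patterns of products is the product over [j] of two-term sums, each of which is the
   mixture of the two signs. *)
rewrite sumEFin -bigA_distr_bigA -prodEFin; apply: eq_bigr => j _.
rewrite big_bool EFinD !qE; apply: beta_law_mixture => //.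
exact: (gd_beta_norm_neq0 N0 gd_rho).
Qed.

Let integral_density_setT j :
  (\int[lebesgue_measure]_(x in setT)
    (signed_root_density p (tnth a j) (tnth b j) x)%:E = 1)%E.
Proof.
rewrite -beta_law_mixture//; last exact: (gd_beta_norm_neq0 N0 gd_rho).
rewrite !preimage_setT (gd_beta_law_setT N0 gd_rho) mule1 -EFinD.
by congr EFin; lra.
Qed.

(** Almost surely the entries of [eps] are signs and [rho] lies in the simplex; there the canonical
    coordinates are the [W j], whose joint law is [joint_W]. *)
Lemma canonical_coords_joint A : (forall j, measurable (A j)) ->
  Q [set t | forall j,
    A j (tnth (canonical_coords p (signed_roots p eps rho t)) j)] =
  (\prod_(j < N) \int[lebesgue_measure]_(x in A j)
    (signed_root_density p (tnth a j) (tnth b j) x)%:E)%E.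
Proof.
move=> mA; rewrite -joint_W//.
have mS : measurable (rho @^-1` simplex).
  rewrite -[X in measurable X]setTI; apply: measurable_funPT => //.
  exact: measurable_simplex.
apply: (@eq_measure_full _ _ _ Q (signs `&` rho @^-1` simplex)).
- exact: measurableI.
- apply: (@measurable_ord_preimages _ _ _ _ (fun j t =>
    tnth (canonical_coords p (signed_roots p eps rho t)) j)) => // j.
  apply: (measurableT_comp (measurable_tnth j)).
  exact: (measurableT_comp (measurable_canonical_coords p)).
- by apply: measurable_ord_preimages.
- rewrite setCI measureU0.
  + exact: signs_full.
  + exact: measurableC.
  + exact: measurableC.
  + exact: (gd_simplex gd_rho).
have CW t j : signs t -> simplex (rho t) ->
    tnth (canonical_coords p (signed_roots p eps rho t)) j = W j t.
  move=> sg sx; rewrite (@canonical_coords_signed_root _ _ _ (rho t) _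
    (fun i => tnth (eps t) i))//.
  - by rewrite /W/= /signed_root/= /rv_coord/= canonical_coords1.
  - by move=> i; have [->|->] := sg i; rewrite ?normrN normr1.
  - by move=> i; rewrite tnth_mktuple.
apply/seteqP; split => t [H [sg sx]]; split=> // j.
  by rewrite -CW//; exact: H.
by rewrite CW//; exact: H.
Qed.

Lemma canonical_coords_marginal j A : measurable A ->
  Q [set t | A (tnth (canonical_coords p (signed_roots p eps rho t)) j)] =
  (\int[lebesgue_measure]_(x in A)
    (signed_root_density p (tnth a j) (tnth b j) x)%:E)%E.
Proof.
exact: (@marginal_of_joint _ _ _ Q _ _
  (fun j t => tnth (canonical_coords p (signed_roots p eps rho t)) j)
  (fun j A => (\int[lebesgue_measure]_(x in A)
    (signed_root_density p (tnth a j) (tnth b j) x)%:E)%E)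
  canonical_coords_joint integral_density_setT).
Qed.

Lemma signed_root_beta j :
  exists eps' Z' : {RV Q >-> R},
    [/\ independent_pair Q eps' Z', rademacher Q eps',
        beta_distributed Q Z' (tnth a j) (tnth b j) &
        forall A, measurable A -> Q (signed_root p eps' Z' @^-1` A) =
          (\int[lebesgue_measure]_(x in A)
             (signed_root_density p (tnth a j) (tnth b j) x)%:E)%E].
Proof.
(* The witnesses are the [j]-th sign and the [j]-th ratio, functions of the independent vectors
   [eps] and [rho]. *)
exists (rv_coord eps j), (Z j); split => //.
- move=> A B mA mB.
  have mE : measurable ((fun e : N.-tuple R => tnth e j) @^-1` A).
    by rewrite -[X in measurable X]setTI; exact: measurable_tnth.
  have mF : measurable ((fun x : N.-tuple R => tnth (canonical_coords 1 x) j) @^-1` B).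
    rewrite -[X in measurable X]setTI.
    exact: (measurableT_comp (measurable_tnth j)).
  exact: (ind_eps_rho mE mF).
- exists (beta_norm (tnth a j) (tnth b j))^-1 => A mA.
  rewrite -[LHS]/(Q (Z j @^-1` A)).
  rewrite (@marginal_of_joint _ _ _ Q _ _ Z
    (fun j => beta_law (tnth a j) (tnth b j))
    (gd_law N0 gd_rho) (gd_beta_law_setT N0 gd_rho))//.
  rewrite [RHS]integral_mkcond.
  apply: eq_integral => x _; rewrite patchE indicE.
  by case: ifPn => _; rewrite ?mulr0 ?mulr1// /beta_kernel !mulrA.
- exact: (@marginal_of_joint _ _ _ Q _ _ W
    (fun j A => (\int[lebesgue_measure]_(x in A)
      (signed_root_density p (tnth a j) (tnth b j) x)%:E)%E)
    joint_W integral_density_setT).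
Qed.

End canonical_coordinates_law.

(** * Transfer from the signed roots to the given vector *)

Theorem proposition2p5 (R : realType) (N : nat) (p : R) (a b : N.-tuple R)
  (d : measure_display) (T : measurableType d) (P : probability T R)
  (X : {RV P >-> N.-tuple R}) :
  (0 < N)%N -> 1 <= p ->
  (forall j : 'I_N, 0 < tnth a j) -> (forall j : 'I_N, 0 < tnth b j) ->
  p_gd_distributed P X p a b ->
  let C : 'I_N -> {RV P >-> R} := fun j => rv_coord (canonical_coords p \o X) j in
  mutual_independent P C /\
  forall j : 'I_N,
    (exists (d' : measure_display) (T' : measurableType d')
       (Q : probability T' R) (eps Z : {RV Q >-> R}),
       [/\ independent_pair Q eps Z,
           rademacher Q eps,
           beta_distributed Q Z (tnth a j) (tnth b j) &
           eq_law P Q (C j) (signed_root p eps Z)]) /\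
    has_density P (C j) (fun x =>
      p * Gamma (tnth a j + tnth b j)
        / (2 * Gamma (tnth a j) * Gamma (tnth b j))
      * `|x| `^ (p * tnth a j - 1) * (1 - `|x| `^ p) `^ (tnth b j - 1)
      * \1_`]-1, 1[ x).
Proof.
move=> N0 p1 _ _ [d' [T' [Q [eps [rho [gd rad ind indr XE]]]]]] C.
have joint := canonical_coords_joint N0 p1 gd rad ind indr.
have marg j A : measurable A -> P (C j @^-1` A) =
    (\int[lebesgue_measure]_(x in A)
      (signed_root_density p (tnth a j) (tnth b j) x)%:E)%E.
  move=> mA; rewrite -(canonical_coords_marginal N0 p1 gd rad ind indr j mA).
  apply: (XE ((fun x => tnth (canonical_coords p x) j) @^-1` A)).
  rewrite -[X in measurable X]setTI.
  exact: (measurableT_comp (measurable_tnth j)).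
split=> [J A mA|j].
  (* Independence over a subset [J] follows from the joint law of all coordinates once the missing
     sets are filled with [setT], which has probability 1. *)
  pose B j := if j \in J then A j else setT.
  have mB j : measurable (B j) by rewrite /B; case: ifP.
  transitivity (P [set t | forall j, B j (C j t)]).
    congr (P _); apply/seteqP; split => t /= H j.
      by rewrite /B; case: ifP => // jJ; exact: H.
    by move=> /= jJ; have := H j; rewrite /B jJ.
  transitivity (Q [set t | forall j,
      B j (tnth (canonical_coords p (signed_roots p eps rho t)) j)]).
    apply: (XE [set x | forall j, B j (tnth (canonical_coords p x) j)]).
    apply: (@measurable_ord_preimages _ _ _ _
      (fun j x => tnth (canonical_coords p x) j)) => // j.
    exact: (measurableT_comp (measurable_tnth j)).
  rewrite joint// [RHS]big_mkcond; apply: eq_bigr => j _.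
  rewrite /B; case: ifP => _; first by rewrite marg.
  by rewrite -marg// preimage_setT probability_setT.
split; last by move=> A; exact: marg.
have [eps' [Z' [H1 H2 H3 H4]]] := signed_root_beta N0 p1 gd rad ind indr j.
exists d', T', Q, eps', Z'; split => // A mA.
by rewrite -[LHS]/(P (C j @^-1` A)) marg// -H4.
Qed.
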